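(* For each $d\ge 1$ there is a constant $c>0$ depending only on $d$ such that the following holds for every integer $n\ge1$. Let $D\subset\mathbb{R}^d$ be a compact set of positive Lebesgue measure, $y=(y_1,\dots,y_d)\in[-1,1]^d$, and $T$ be an affine transformation of $\mathbb{R}^d$ such that $D\subset T([-1,1]^d)$ and $Ty\in D$. Then $$C(\mathcal{P}_n,D,Ty)\ge c\,|\det T|^{-1}\rho_n(y_1)^{-1}\rho_n(y_2)^{-1}\cdots\rho_n(y_d)^{-1}.$$
   Context: $\rho_n(t)=\frac1{n^2}+\frac1n\sqrt{1-t^2}$ for $t\in[-1,1]$. Affine transformations $Tx=x_0+Ax$ are always assumed non-degenerate, and $\det T:=\det A\ne0$. $\mathcal{P}_n=\mathcal{P}_{n,d}$ is the space of real algebraic polynomials in $d$ variables of total degree $\le n$. For a compact set $D\subset\mathbb{R}^d$ of positive Lebesgue measure and $x\in\mathbb{R}^d$, $C(\mathcal{P}_n,D,x)=\sum_{k=1}^N\phi_k(x)^2$, where $\{\phi_k\}_{k=1}^N$ is any basis of $\mathcal{P}_n$ that is orthonormal in $L_2(D)$ with respect to Lebesgue measure (the value does not depend on the choice of the orthonormal basis). *)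

(* Defs.v *)
From HB Require Import structures.
From mathcomp Require Import all_boot all_order all_algebra.
(* The notations of mpoly clash with those of analysis, so they are left out. *)
From mathcomp Require mpoly.
Import (canonicals, coercions) mpoly.
From mathcomp Require Import all_classical all_reals all_analysis.

Set Implicit Arguments.
Unset Strict Implicit.
Unset Printing Implicit Defensive.
Import Order.TTheory GRing.Theory Num.Theory.
Import numFieldNormedType.Exports.

Local Open Scope classical_set_scope.
Local Open Scope ring_scope.

(* Points of R^d are column vectors, so that an affine map reads x0 + A *m x.
   They carry the product (equivalently, Borel) sigma-algebra generated by the
   coordinates, as the library does for tuples. *)
Definition measure_cV_display : measure_display.
Proof. exact default_measure_display. Qed.

Section measurable_cV.
Variables (R : realType) (d : nat).

Definition coord_cV (i : 'I_d) (x : 'cV[R]_d) : measurableTypeR R := x i ord0.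

Let cV_set0 : g_sigma_preimage coord_cV set0.
Proof. exact: sigma_algebra0. Qed.

Let cV_setC A : g_sigma_preimage coord_cV A -> g_sigma_preimage coord_cV (~` A).
Proof. exact: sigma_algebraC. Qed.

Let cV_bigcup (F : _^nat) : (forall i, g_sigma_preimage coord_cV (F i)) ->
  g_sigma_preimage coord_cV (\bigcup_i (F i)).
Proof. exact: sigma_algebra_bigcup. Qed.

HB.instance Definition _ := @isMeasurable.Build measure_cV_display
  'cV[R]_d (g_sigma_preimage coord_cV) cV_set0 cV_setC cV_bigcup.

End measurable_cV.

Lemma measurable_coord_cV (R : realType) d (i : 'I_d) :
  measurable_fun [set: 'cV[R]_d] (coord_cV i).
Proof.
move=> _ Y mY; rewrite setTI; apply: sub_sigma_algebra => /=.
rewrite -bigcup_seq/=; exists i => /=; first by rewrite mem_index_enum.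
by exists Y => //; rewrite setTI.
Qed.

Lemma measurable_fun_cVP (R : realType) d disp (T : measurableType disp)
    (f : T -> 'cV[R]_d) :
  (forall i, measurable_fun [set: T] (coord_cV i \o f)) ->
  measurable_fun [set: T] f.
Proof.
move=> mf _ A mA; rewrite setTI.
have : g_sigma_preimage (fun i => coord_cV i \o f) `<=` measurable.
  apply: smallest_sub; first exact: sigma_algebra_measurable.
  case: d => [|d] in f mf A mA *; first by rewrite big_ord0.
  rewrite -bigcup_mkord_ord; apply: bigcup_sub => i Ii.
  by move=> B [C mC <-]; exact: mf.
rewrite g_sigma_preimage_comp; apply.
by exists A => //; rewrite setTI.
Qed.

Definition cons_cV (R : realType) d (p : measurableTypeR R * 'cV[R]_d) :
  'cV[R]_d.+1 := col_mx (p.1%:M : 'M[R]_1) p.2.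

Definition behead_cV (R : realType) d (x : 'cV[R]_d.+1) : 'cV[R]_d :=
  @dsubmx R 1 d 1 x.

Lemma coord_cV0_cons (R : realType) d (p : measurableTypeR R * 'cV[R]_d) :
  coord_cV ord0 (cons_cV p) = p.1.
Proof.
rewrite /coord_cV /cons_cV.
rewrite (_ : ord0 = lshift d (ord0 : 'I_1)); last exact: val_inj.
by rewrite [LHS]col_mxEu mxE.
Qed.

Lemma coord_cVS_cons (R : realType) d (p : measurableTypeR R * 'cV[R]_d)
    (i : 'I_d) :
  coord_cV (lift ord0 i) (cons_cV p) = coord_cV i p.2.
Proof.
rewrite /coord_cV /cons_cV.
rewrite (_ : lift ord0 i = rshift 1 i); last exact: val_inj.
by rewrite [LHS]col_mxEd.
Qed.

Lemma measurable_cons_cV (R : realType) d :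
  measurable_fun setT (@cons_cV R d).
Proof.
apply: measurable_fun_cVP => i.
case: (unliftP ord0 i) => [j ->|->].
- rewrite (_ : _ \o _ = coord_cV j \o snd).
    by apply: measurableT_comp => //; exact: measurable_coord_cV.
  by apply/funext => p /=; rewrite coord_cVS_cons.
- rewrite (_ : _ \o _ = fst) //.
  by apply/funext => p /=; rewrite coord_cV0_cons.
Qed.

Lemma measurable_behead_cV (R : realType) d :
  measurable_fun setT (@behead_cV R d).
Proof.
apply: measurable_fun_cVP => i.
rewrite (_ : _ \o _ = coord_cV (lift ord0 i)); first exact: measurable_coord_cV.
apply/funext => x /=; rewrite /coord_cV /behead_cV mxE.
by congr (x _ _); exact: val_inj.
Qed.

(* Lebesgue measure on R^d, by induction on d: the unit mass on the one-point
   space R^0, and the product of Lebesgue measure on R with the measure on R^d,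
   transported by cons_cV, on R^(d+1). *)
Section lebesgue_cV_succ.
Variables (R : realType) (d : nat).
Variable mu : {sigma_finite_measure set 'cV[R]_d -> \bar R}.
Local Open Scope ereal_scope.

Definition lebesgue_cV_succ : set 'cV[R]_d.+1 -> \bar R :=
  pushforward (lebesgue_measure \x mu) (@cons_cV R d).

Let succ0 : lebesgue_cV_succ set0 = 0.
Proof. by rewrite /lebesgue_cV_succ /pushforward preimage_set0 measure0. Qed.

Let succ_ge0 A : 0 <= lebesgue_cV_succ A.
Proof. by rewrite /lebesgue_cV_succ /pushforward measure_ge0. Qed.

Let succ_sigma_additive : semi_sigma_additive lebesgue_cV_succ.
Proof.
move=> F mF tF mUF; rewrite /lebesgue_cV_succ /pushforward preimage_bigcup.
apply: measure_semi_sigma_additive.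
- by move=> n; rewrite -[X in measurable X]setTI; exact: measurable_cons_cV.
- apply/trivIsetP => /= i j _ _ ij; rewrite -preimage_setI.
  by move/trivIsetP : tF => /(_ _ _ _ _ ij) ->//; rewrite preimage_set0.
- rewrite -preimage_bigcup -[X in measurable X]setTI.
  exact: measurable_cons_cV.
Qed.

HB.instance Definition _ := isMeasure.Build _ _ _ lebesgue_cV_succ
  succ0 succ_ge0 succ_sigma_additive.

Let succ_sigma_finite : sigma_finite setT lebesgue_cV_succ.
Proof.
have /sigma_finiteP[F [TF ndF Foo]] :=
  sigma_finiteT (@lebesgue_measure R).
have /sigma_finiteP[G [TG ndG Goo]] := sigma_finiteT mu.
exists (fun n => (coord_cV ord0 @^-1` F n) `&` (@behead_cV R d @^-1` G n)).
  apply/esym; rewrite -subTset => x _.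
  have : [set: measurableTypeR R] (coord_cV ord0 x) by [].
  rewrite TF => -[n _ Fn].
  have : [set: 'cV[R]_d] (behead_cV x) by [].
  rewrite TG => -[k _ Gk]; exists (maxn n k) => //; split => /=.
  - by move: Fn; exact/subsetPset/ndF/leq_maxl.
  - by move: Gk; exact/subsetPset/ndG/leq_maxr.
move=> k; have [mF Fk] := Foo k; have [mG Gk] := Goo k.
split.
  apply: measurableI; rewrite -[X in measurable X]setTI.
  - exact: measurable_coord_cV.
  - exact: measurable_behead_cV.
rewrite /lebesgue_cV_succ /pushforward (_ : _ @^-1` _ = F k `*` G k).
  by rewrite product_measure1E// lte_mul_pinfty// ge0_fin_numE.
apply/seteqP; split => p /=;
  by rewrite coord_cV0_cons /behead_cV /cons_cV col_mxKd.
Qed.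

HB.instance Definition _ := Measure_isSigmaFinite.Build _ _ _ lebesgue_cV_succ
  succ_sigma_finite.

End lebesgue_cV_succ.

Fixpoint lebesgue_cV (R : realType) (d : nat) :
    {sigma_finite_measure set 'cV[R]_d -> \bar R} :=
  match d with
  | 0 => (\d_(0 : 'cV[R]_0))
  | d'.+1 => (lebesgue_cV_succ (lebesgue_cV R d'))
  end.

Section christoffel.
Variables (R : realType) (d : nat).
Implicit Types (n : nat) (p : mpoly.mpoly d R) (x : 'cV[R]_d) (D : set 'cV[R]_d).

Definition peval p x : R := mpoly.meval (fun i => x i ord0) p.

(* msize is 1 + the total degree, and 0 for the zero polynomial. *)
Definition poly_space n : set (mpoly.mpoly d R) :=
  [set p | (mpoly.msize p <= n.+1)%N].

Definition is_basis n N (phi : 'I_N -> mpoly.mpoly d R) : Prop :=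
  [/\ forall k, poly_space n (phi k),
      forall a : 'I_N -> R, \sum_k a k *: phi k = 0 -> forall k, a k = 0
    & forall p, poly_space n p -> exists a : 'I_N -> R, p = \sum_k a k *: phi k].

Definition orthonormal_in D N (phi : 'I_N -> mpoly.mpoly d R) : Prop :=
  forall j k, (\int[lebesgue_cV R d]_(x in D) (peval (phi j) x * peval (phi k) x)%:E
               = ((j == k)%:R)%:E)%E.

(* The sum over an orthonormal basis does not depend on the basis when D is
   compact of positive measure; get selects this common value (and is 0 by
   default if there is no orthonormal basis). *)
Definition christoffel n D x : R :=
  get [set v : R | exists N (phi : 'I_N -> mpoly.mpoly d R),
    [/\ is_basis n phi, orthonormal_in D phi
      & v = \sum_k peval (phi k) x ^+ 2]].

End christoffel.

Definition rho (R : realType) (n : nat) (t : R) : R :=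
  (n%:R ^+ 2)^-1 + n%:R^-1 * Num.sqrt (1 - t ^+ 2).

Definition cube (R : realType) (d : nat) : set 'cV[R]_d :=
  [set y | forall i, -1 <= y i ord0 <= 1].
Arguments cube : clear implicits.

Definition affine (R : realType) (d : nat) (x0 : 'cV[R]_d) (A : 'M[R]_d)
  (x : 'cV[R]_d) : 'cV[R]_d := x0 + A *m x.

(* Main.v *)
Require Import Defs.
From mathcomp Require Import all_boot all_order all_algebra.
From mathcomp Require mpoly.
Import (canonicals, coercions) mpoly.
From mathcomp Require Import all_classical all_reals all_analysis.
From mathcomp Require Import measurable_realfun ring lra zify.
Set Implicit Arguments.
Unset Strict Implicit.
Unset Printing Implicit Defensive.
Import Order.TTheory GRing.Theory Num.Theory.
Import numFieldNormedType.Exports.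
Local Open Scope classical_set_scope.
Local Open Scope ring_scope.

(** The Christoffel function [C(P_n, D, x)] is the maximum of
    [Q(x)^2 / int_D Q^2] over the nonzero [Q] in [P_n]; the half of this fact
    that matters here, [christoffel_ge], is the Cauchy-Schwarz inequality in an
    orthonormal basis.  It is therefore enough to exhibit one [Q] of degree at
    most [n] with [Q(Ty) = 1] and
    [int_D Q^2 <= C^d * |det T| * prod_i rho_n(y_i)].

    The candidate is a product [Q(x) = prod_i q_i((T^-1 x)_i)] of univariate
    polynomials of degree at most [n %/ d].  As [D] is contained in the image of
    the cube, the change of variables [integral_affine] and Fubini
    ([integral_prod_le]) bound [int_D Q^2] by [|det T|] times the product of the
    integrals of the [q_i^2] over [[-1, 1]].  So everything reduces to dimension
    one: for every [t] in [[-1, 1]] find [q] of degree at most [n %/ d] with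
    [q(t) = 1] and [int_{-1}^1 q^2 <= C rho_n(t)] ([localized_poly]).

    In dimension one put [x = cos s], [t = cos th], and let [q] be proportional
    to a product of two kernels.  The first, [h], is the reproducing kernel
    [sum_j cos(j th) cos(j s)] of order about [n]: it concentrates near [th] at
    scale [1 / n] for the measure [ds], and [int_0^pi h^2 ds <= pi h(t)].  The
    measure of interest, however, is [dx = sin s ds], and at the endpoints the
    extra factor [sin s] has to be won.  This is the role of the second factor,
    a Dirichlet kernel [W_k] peaked at the endpoint of [[-1, 1]] closest to [t]:
    the closed form of [W_k] gives [W_k^2 sin s <= 2 (2 k + 1)] everywhere
    ([dirichlet_weight]), while [W_k(|t|) >= k + 1] as long as
    [k^2 (1 - |t|) <= 1 / 2] ([dirichlet_ge]).  Choosing [k] as large as this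
    condition and the degree permit, [1 / (k + 1)] is comparable to
    [1 / n + sqrt (1 - t^2)], and the quotient of the integral by the squared
    value at [t] is of order [1 / ((k + 1) n)], that is, of order [rho_n(t)].

    Two facts about [lebesgue_cV] support the reduction.  The measure is built
    one coordinate at a time, so its behaviour under affine maps is proved by
    factoring the matrix into block triangular matrices, for which the integrals
    over the first coordinate and over the remaining ones are transformed
    separately.  And since [christoffel] selects a
    value by choice, an orthonormal basis must be shown to exist: the Gram
    matrix of the monomials is positive definite because a nonzero polynomial
    vanishes only on a null set ([lebesgue_zeros]). *)

(** * Chebyshev polynomials and the Dirichlet kernel *)

Section chebyshev.
Variable R : realType.
Implicit Types (s u x : R).

(** Carrying two consecutive polynomials makes the three-term recurrence
    structural. *)
Fixpoint chebyshev_pair (n : nat) : {poly R} * {poly R} :=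
  if n is m.+1 then
    let: (p, q) := chebyshev_pair m in (q, 2%:P * 'X * q - p)
  else (1, 'X).
Definition chebyshev n := (chebyshev_pair n).1.

Lemma chebyshev0 : chebyshev 0 = 1. Proof. by []. Qed.
Lemma chebyshev1 : chebyshev 1 = 'X. Proof. by []. Qed.
Lemma chebyshevSS n :
  chebyshev n.+2 = 2%:P * 'X * chebyshev n.+1 - chebyshev n.
Proof. by rewrite /chebyshev /=; case: (chebyshev_pair n). Qed.

Lemma nat_two_step_ind (P : nat -> Prop) :
  P 0%N -> P 1%N -> (forall n, P n -> P n.+1 -> P n.+2) -> forall n, P n.
Proof.
move=> P0 P1 PS n; suff [] : P n /\ P n.+1 by [].
by elim: n => [|n [IH1 IH2]]; split=> //; exact: PS.
Qed.

Lemma size_chebyshev n : (size (chebyshev n) <= n.+1)%N.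
Proof.
elim/nat_two_step_ind: n => [||n IH1 IH2].
- by rewrite chebyshev0 size_poly1.
- by rewrite chebyshev1 size_polyX.
rewrite chebyshevSS (leq_trans (size_polyD _ _))// geq_max size_polyN.
rewrite (leq_trans IH1) ?andbT; last by rewrite ltnS leqW.
rewrite -mulrA mul_polyC (leq_trans (size_scale_leq _ _))//.
by rewrite (leq_trans (size_polyMleq _ _))// size_polyX; exact: IH2.
Qed.

Lemma chebyshev_cos n s : (chebyshev n).[cos s] = cos (n%:R * s).
Proof.
elim/nat_two_step_ind: n => [||n IH1 IH2].
- by rewrite chebyshev0 mul0r cos0 hornerE.
- by rewrite chebyshev1 mul1r hornerX.
rewrite chebyshevSS !hornerE IH1 IH2.
have -> : n.+2%:R * s = n.+1%:R * s + s by rewrite -[n.+2%:R]natr1; ring.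
have -> : n%:R * s = n.+1%:R * s - s by rewrite -[n.+1%:R]natr1; ring.
by rewrite cosB cosD; ring.
Qed.

(** In the variable [x = cos s] this is the Dirichlet kernel
    [1 + 2 cos s + ... + 2 cos (k s)]. *)
Definition dirichlet k : {poly R} := 1 + \sum_(j < k) 2 *: chebyshev j.+1.

Lemma dirichletS k : dirichlet k.+1 = dirichlet k + 2 *: chebyshev k.+1.
Proof. by rewrite /dirichlet big_ord_recr /= addrA. Qed.

Lemma size_dirichlet k : (size (dirichlet k) <= k.+1)%N.
Proof.
elim: k => [|k IH]; first by rewrite /dirichlet big_ord0 addr0 size_poly1.
rewrite dirichletS (leq_trans (size_polyD _ _))// geq_max (leq_trans IH)//=.
by rewrite (leq_trans (size_scale_leq _ _))// size_chebyshev.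
Qed.

(** The closed form of the Dirichlet kernel, cleared of its denominator: the
    sum telescopes after multiplication by [sin u]. *)
Lemma dirichlet_sin k u :
  (dirichlet k).[cos (2 * u)] * sin u = sin ((2 * k + 1)%:R * u).
Proof.
elim: k => [|k IH].
  by rewrite /dirichlet big_ord0 addr0 hornerE !mul1r.
rewrite dirichletS hornerD mulrDl IH hornerZ chebyshev_cos.
rewrite (_ : (2 * k.+1 + 1)%:R * u = k.+1%:R * (2 * u) + u); last first.
  by rewrite natrD natrM; ring.
rewrite (_ : (2 * k + 1)%:R * u = k.+1%:R * (2 * u) - u); last first.
  by rewrite natrD natrM -natr1; ring.
by rewrite sinB sinD; ring.
Qed.

Lemma dirichlet_le k s : `|(dirichlet k).[cos s]| <= (2 * k + 1)%:R.
Proof.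
elim: k => [|k IH].
  by rewrite /dirichlet big_ord0 addr0 hornerE normr1.
rewrite dirichletS hornerD (le_trans (ler_normD _ _))//.
rewrite (_ : (2 * k.+1 + 1)%:R = (2 * k + 1)%:R + 2 * 1 :> R); last first.
  by rewrite !natrD !natrM -natr1; ring.
rewrite lerD// hornerZ normrM ger0_norm// ler_pM2l// chebyshev_cos.
exact: cos_max.
Qed.

(** With [s = 2 u] one has [sin s <= 2 sin u], so one of the two factors of the
    square absorbs [sin u] and becomes a sine, by [dirichlet_sin], and the other
    is at most [2 k + 1].  The bound is linear in [k], whereas the square alone
    is quadratic at [s = 0]: the weight [sin s] gains the factor [k]. *)
Lemma dirichlet_weight k s : 0 <= s <= pi ->
  (dirichlet k).[cos s] ^+ 2 * sin s <= 2 * (2 * k + 1)%:R.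
Proof.
move=> /andP[s0 spi]; set D := (dirichlet k).[cos s].
have cu : 0 <= cos (s / 2) by apply: cos_ge0_pihalf; apply/andP; split; lra.
have cu1 := cos_le1 (s / 2).
have su : 0 <= sin (s / 2) by apply: sin_ge0_pi; apply/andP; split; lra.
have -> : sin s = 2 * (sin (s / 2) * cos (s / 2)).
  by rewrite [in LHS](_ : s = (s / 2) *+ 2) ?sin_mulr2n; [ring|field].
have Ds : `|D * sin (s / 2)| <= 1.
  rewrite /D; have -> : cos s = cos (2 * (s / 2)) by congr cos; field.
  by rewrite dirichlet_sin; exact: sin_max.
have -> : D ^+ 2 * (2 * (sin (s / 2) * cos (s / 2))) =
  2 * (D * (D * sin (s / 2)) * cos (s / 2)) by ring.
rewrite ler_pM2l// (le_trans (ler_norm _))// !normrM -normrM (ger0_norm cu).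
rewrite -[leRHS]mulr1 ler_pM// ?mulr_ge0// -[leRHS]mulr1 ler_pM//.
exact: dirichlet_le.
Qed.

Lemma sin_natmul_le n u : `|sin (n%:R * u)| <= n%:R * `|sin u|.
Proof.
elim: n => [|n IH]; first by rewrite !mul0r sin0 normr0.
rewrite -natr1 !mulrDl !mul1r sinD (le_trans (ler_normD _ _))// !normrM lerD//.
  by rewrite (le_trans _ IH)// ler_piMr// cos_max.
by rewrite ler_piMl// cos_max.
Qed.

(** The half-angle form of [sin_natmul_le], from [1 - cos x = 2 sin^2 (x / 2)].
    It says that the Chebyshev polynomials have slope at most [n^2] at [1]. *)
Lemma cos_natmul_ge n s : 1 - n%:R ^+ 2 * (1 - cos s) <= cos (n%:R * s).
Proof.
have E x : cos x = 1 - 2 * sin (x / 2) ^+ 2.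
  rewrite [in LHS](_ : x = (x / 2) *+ 2); last by field.
  by rewrite cos_mulr2n cos2sin2; ring.
rewrite (E s) (E (n%:R * s)) -mulrA.
have := sin_natmul_le n (s / 2); rewrite -(ler_sqr (R:=R)) ?nnegrE ?mulr_ge0//.
by rewrite exprMn !real_normK ?num_real//; lra.
Qed.

(** Up to the angle [1 / k], where the hypothesis holds, every cosine in the
    kernel is at least [1 / 2]. *)
Lemma dirichlet_ge k s : k%:R ^+ 2 * (1 - cos s) <= 2^-1 ->
  (k.+1)%:R <= (dirichlet k).[cos s].
Proof.
move=> ks; rewrite /dirichlet hornerD hornerC -nat1r lerD2l horner_sum.
have -> : k%:R = \sum_(j < k) 1 :> R by rewrite sumr_const card_ord.
apply: ler_sum => j _; rewrite hornerZ chebyshev_cos.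
suff : 2^-1 <= cos (j.+1%:R * s) by lra.
have : (j.+1)%:R ^+ 2 * (1 - cos s) <= k%:R ^+ 2 * (1 - cos s).
  by rewrite ler_wpM2r ?subr_ge0 ?cos_le1// ler_sqr ?nnegrE ?ler_nat.
by have := cos_natmul_ge j.+1 s; lra.
Qed.

(** The reproducing kernel of the polynomials of degree at most [l] for the
    arcsine measure, up to a factor and to the weight of its constant term. *)
Definition cos_kernel l th : {poly R} :=
  \sum_(j < l.+1) cos (j%:R * th) *: chebyshev j.

Lemma size_cos_kernel l th : (size (cos_kernel l th) <= l.+1)%N.
Proof.
apply: (leq_trans (size_sum _ _ _)); apply/bigmax_leqP => j _.
by rewrite (leq_trans (size_scale_leq _ _))// (leq_trans (size_chebyshev _)).
Qed.

Lemma cos_kernelE l th s : (cos_kernel l th).[cos s] =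
  \sum_(j < l.+1) cos (j%:R * th) * cos (j%:R * s).
Proof.
by rewrite horner_sum; apply: eq_bigr => j _; rewrite hornerZ chebyshev_cos.
Qed.

(** Some of the terms [cos^2 (j th)] may vanish, but [cos^2 (j th)] and
    [cos^2 (2 j th)] cannot be small together: with [c = cos^2 (j th)] their sum
    is [c + (2 c - 1)^2 >= 7 / 16].  Both families, for [j <= l], are part of
    the sum of order [2 l]. *)
Lemma cos_kernel_diag_ge l th :
  7 / 32 * (l.+1)%:R <= (cos_kernel l.*2 th).[cos th].
Proof.
rewrite cos_kernelE; set K := \sum_(_ < _) _.
have K1 : \sum_(j < l.+1) cos (j%:R * th) ^+ 2 <= K.
  rewrite /K (big_ord_widen _ (fun j => cos (j%:R * th) ^+ 2)
    (_ : (l < l.*2.+1)%N)); last lia.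
  rewrite big_mkcond; apply: ler_sum => j _; case: ifP => _.
    by rewrite expr2.
  by rewrite -expr2 sqr_ge0.
have K2 : \sum_(j < l.+1) cos (j.*2%:R * th) ^+ 2 <= K.
  pose f (j : 'I_l.+1) : 'I_l.*2.+1 := inord j.*2.
  have fE j : f j = j.*2 :> nat by rewrite inordK// ltnS leq_double -ltnS.
  have fI : injective f.
    by move=> i j /(congr1 val); rewrite /= !fE => /double_inj/val_inj.
  have -> : \sum_(j < l.+1) cos (j.*2%:R * th) ^+ 2 =
      \sum_(i in [set f j | j in 'I_l.+1]%SET) cos (i%:R * th) ^+ 2.
    rewrite big_imset/=; last by move=> ? ? _ _ /fI.
    by apply: eq_bigr => j _; rewrite fE.
  rewrite big_mkcond; apply: ler_sum => j _; case: ifP => _.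
    by rewrite expr2.
  by rewrite -expr2 sqr_ge0.
have : \sum_(j < l.+1) (7/16 : R) <= \sum_(j < l.+1) cos (j%:R * th) ^+ 2
     + \sum_(j < l.+1) cos (j.*2%:R * th) ^+ 2.
  rewrite -big_split/=; apply: ler_sum => j _.
  rewrite (_ : j.*2%:R * th = (j%:R * th) *+ 2); last first.
    by rewrite -muln2 natrM; ring.
  by rewrite cos_mulr2n; have := sqr_ge0 (cos (j%:R * th) ^+ 2 - 3 / 8); lra.
rewrite sumr_const card_ord -mulr_natr; lra.
Qed.

(** The primitive of [s |-> cos (r s)] that vanishes at [0]. *)
Definition cos_primitive (r s : R) : R :=
  if r == 0 then s else r^-1 * sin (r * s).

Lemma is_derive_cos_primitive r s :
  is_derive s 1 (cos_primitive r) (cos (r * s)).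
Proof.
case: (eqVneq r 0) => [->|r0].
  have -> : cos_primitive 0 = id.
    by apply/funext => x; rewrite /cos_primitive eqxx.
  by rewrite mul0r cos0; exact: is_derive_id.
pose g (x : R) := r * x.
have dg : is_derive s 1 g r.
  by apply: is_derive_eq; rewrite /= /GRing.scale /= mulr1.
have -> : cos_primitive r = r^-1 *: (sin \o g).
  by apply/funext => x; rewrite /cos_primitive (negbTE r0).
by apply: is_derive_eq; rewrite /GRing.scale/= /g; field.
Qed.

Lemma cos_primitive0 r : cos_primitive r 0 = 0 :> R.
Proof. by rewrite /cos_primitive mulr0 sin0 mulr0 if_same. Qed.

Lemma cos_primitive_pi r : sin (r * pi) = 0 ->
  cos_primitive r pi = (r == 0)%:R * pi :> R.
Proof.
by rewrite /cos_primitive => ->; case: eqP; rewrite ?mul1r// mulr0 mul0r.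
Qed.

Lemma sin_natmul_pi n : sin (n%:R * pi) = 0 :> R.
Proof.
apply/eqP; rewrite -normr_le0 (le_trans (sin_natmul_le _ _))//.
by rewrite sinpi normr0 mulr0.
Qed.

End chebyshev.

(** * Integrals of squares in the variable cos s *)

Section integrals.
Variable R : realType.

(** The [cos (j s)] are orthogonal on [[0, pi]], with square norms [pi] for
    [j = 0] and [pi / 2] otherwise.  The statement gives a primitive instead of
    an integral because [integral_product_le] compares primitives. *)
Lemma cos_sum_sq_primitive n (a : 'I_n -> R) : exists H : R -> R,
  [/\ forall s : R, is_derive s 1 H ((\sum_(j < n) a j * cos (j%:R * s)) ^+ 2),
      H 0 = 0 & H pi <= pi * \sum_(j < n) a j ^+ 2].
Proof.
pose P (i j : 'I_n) : R -> R :=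
  cos_primitive (i%:R + j%:R) \+ cos_primitive (i%:R - j%:R).
have PE i j s : P i j s =
  cos_primitive (i%:R + j%:R) s + cos_primitive (i%:R - j%:R) s by [].
pose c (i j : 'I_n) := a i * a j / 2.
pose H := \sum_i \sum_j c i j *: P i j.
have HE s : H s = \sum_i \sum_j c i j * P i j s.
  by rewrite /H fct_sumE; apply: eq_bigr => i _; rewrite fct_sumE.
have dP i j (s : R) : is_derive s 1 (P i j)
    (cos ((i%:R + j%:R) * s) + cos ((i%:R - j%:R) * s)).
  by apply: is_deriveD; exact: is_derive_cos_primitive.
exists H; split.
- move=> s.
  have -> : (\sum_(j < n) a j * cos (j%:R * s)) ^+ 2 = \sum_i \sum_j
     c i j *: (cos ((i%:R + j%:R) * s) + cos ((i%:R - j%:R) * s)).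
    rewrite expr2 mulr_suml; apply: eq_bigr => i _.
    rewrite mulr_sumr; apply: eq_bigr => j _.
    by rewrite /c mulrDl mulrBl cosD cosB /GRing.scale/=; field.
  by do 2 apply: is_derive_sum => ?; exact: is_deriveZ.
- rewrite HE big1// => i _; rewrite big1// => j _.
  by rewrite PE !cos_primitive0 addr0 mulr0.
have Ppi i j : P i j pi = (((i + j)%N == 0%N)%:R + (i == j)%:R) * pi.
  have sD : sin ((i%:R + j%:R) * pi) = 0 :> R by rewrite -natrD sin_natmul_pi.
  have sB : sin ((i%:R - j%:R) * pi) = 0 :> R.
    by rewrite mulrBl sinB !sin_natmul_pi mul0r mulr0 subr0.
  rewrite PE !cos_primitive_pi// -mulrDl.
  by rewrite subr_eq0 eqr_nat -natrD pnatr_eq0.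
rewrite HE mulr_sumr; apply: ler_sum => i _.
rewrite (bigD1 i)//= big1 => [|j ji]; last first.
  rewrite Ppi [i == j]eq_sym (negbTE ji) addr0 addn_eq0.
  rewrite (_ : _ && _ = false) ?mul0r ?mulr0//.
  apply/negbTE; apply: contra ji => /andP[/eqP i0 /eqP j0].
  by apply/eqP/val_inj; rewrite /= i0 j0.
rewrite addr0 Ppi eqxx /c.
have b1 : (((i + i)%N == 0%N)%:R : R) <= 1 by case: (_ == _).
have ai0 := sqr_ge0 (a i); have pi0 := pi_gt0 R.
set b := ((i + i)%N == 0%N)%:R in b1 *.
have -> : a i * a i / 2 * ((b + 1%:R) * pi) = pi * a i ^+ 2 * ((b + 1) / 2).
  by field.
by rewrite ler_piMr ?(mulr_ge0 (ltW pi0) ai0)//; lra.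
Qed.
Lemma poly_primitive (p : {poly R}) : exists P : {poly R}, P^`() = p.
Proof.
exists (\poly_(i < (size p).+1) (p`_i.-1 / i%:R)); apply/polyP => i.
rewrite coef_deriv coef_poly ltnS /=; case: ltnP => [_|le_p].
  by rewrite -[LHS]mulr_natr divfK// pnatr_eq0.
by rewrite [RHS]nth_default// mul0rn.
Qed.

Lemma integral_poly (p P : {poly R}) : P^`() = p ->
  (\int[lebesgue_measure]_(x in `[(-1)%R, 1%R]) (p.[x])%:E =
   (P.[1] - P.[-1])%:E)%E.
Proof.
move=> Pp; rewrite (@continuous_FTC2 _ _ (horner P)) ?EFinB//.
- exact/continuous_subspaceT/continuous_horner.
- split=> [x _| |]; first exact: derivable_horner.
  + by apply: cvg_at_right_filter; exact: continuous_horner.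
  + by apply: cvg_at_left_filter; exact: continuous_horner.
- by move=> x _; rewrite -derivE Pp.
Qed.

(** The sign places the peak of the Dirichlet kernel at either end of
    [[-1, 1]]; the reflection [x |-> - x] is [s |-> pi - s]. *)
Lemma dirichlet_weight_sign k (b : bool) (s : R) : 0 <= s <= pi ->
  (dirichlet R k).[(-1) ^+ b * cos s] ^+ 2 * sin s <= 2 * (2 * k + 1)%:R.
Proof.
case: b => /= s0pi; last by rewrite expr0 mul1r; exact: dirichlet_weight.
rewrite expr1 mulN1r.
have -> : - cos s = cos (pi - s) by rewrite cosB cospi sinpi; ring.
have -> : sin s = sin (pi - s) by rewrite sinB cospi sinpi; ring.
by apply: dirichlet_weight; lra.
Qed.

(** Under [x = cos s] the left-hand side becomes the integral over [[0, pi]] of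
    [c^2 W^2 h^2 sin s], with [W] the Dirichlet factor and [h] the kernel.  By
    [dirichlet_weight] the weight [W^2 sin s] is at most [2 (2 k + 1)], and what
    remains is the integral of [h^2], which orthogonality bounds by
    [pi h(cos th)]. *)
Lemma integral_product_le k l (b : bool) (c th : R) :
  let q := c *: ((dirichlet R k \Po ((-1) ^+ b *: 'X)) * cos_kernel l th) in
  (\int[lebesgue_measure]_(x in `[(-1)%R, 1%R]) (q.[x] ^+ 2)%:E <=
   (c ^+ 2 * (2 * (2 * k + 1)%:R * (pi * (cos_kernel l th).[cos th])))%:E)%E.
Proof.
rewrite /=; set q := c *: _; have [P Pq] := poly_primitive (q ^+ 2).
under eq_integral do rewrite -horner_exp.
rewrite (integral_poly Pq) lee_fin.
have [H [dH H0 Hpi]] :=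
  cos_sum_sq_primitive (fun j : 'I_l.+1 => cos (j%:R * th)).
pose M := c ^+ 2 * (2 * (2 * k + 1)%:R).
have M0 : 0 <= M by rewrite mulr_ge0 ?sqr_ge0// mulr_ge0.
pose F := M *: H + (horner P \o cos).
have dF (s : R) : is_derive s 1 F
    (M * (cos_kernel l th).[cos s] ^+ 2 - q.[cos s] ^+ 2 * sin s).
  apply: is_derive_eq; rewrite Pq horner_exp cos_kernelE /GRing.scale/=.
  by rewrite mulrN.
(* F is the difference of the two primitives, so the inequality between the
   integrands says that F is nondecreasing. *)
have : F 0 <= F pi.
  apply: (@ger0_derive1_le_cc _ F 0 pi) => //; rewrite ?in_itv/= ?pi_ge0 ?lexx//.
  - move=> s; rewrite in_itv/= => /andP[s0 spi].
    rewrite derive1E (@derive_val _ _ _ _ _ _ _ (dF s)) subr_ge0.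
    rewrite /q hornerZ hornerM horner_comp hornerZ hornerX !exprMn.
    have s0pi : 0 <= s <= pi by rewrite !ltW.
    have := dirichlet_weight_sign k b s0pi.
    set D := (dirichlet R k).[_]; set h := (cos_kernel l th).[_] => Dle.
    have -> : c ^+ 2 * (D ^+ 2 * h ^+ 2) * sin s =
      c ^+ 2 * (D ^+ 2 * sin s) * h ^+ 2 by ring.
    by rewrite ler_wpM2r ?sqr_ge0// ler_wpM2l ?sqr_ge0.
  - apply: continuous_subspaceT => s; apply: differentiable_continuous.
    by apply/derivable1_diffP; exact: (@ex_derive _ _ _ _ _ _ _ (dF s)).
rewrite /F /= !fctE /= H0 cos0 cospi /GRing.scale/= mulr0 add0r.
have -> : (cos_kernel l th).[cos th] = \sum_(j < l.+1) cos (j%:R * th) ^+ 2.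
  by rewrite cos_kernelE; apply: eq_bigr => j _; rewrite expr2.
have := ler_wpM2l M0 Hpi.
rewrite [in X in X -> _]/M -!mulrA.
lra.
Qed.
(** * Localized polynomials on the interval *)

(** The degree [n %/ d] is shared between a Dirichlet factor of order [k <= a]
    and a kernel of order [2 a], where [a = n %/ (3 d)].  The kernel contributes
    a factor [a + 1] of order [n]; the Dirichlet factor contributes [k + 1], of
    order [1 / (1 / n + sqrt (1 - t^2))] whichever of its two constraints is the
    binding one. *)
Lemma localized_poly (d : nat) : (0 < d)%N -> exists2 C : R, 0 < C &
  forall (n : nat) (t : R), (1 <= n)%N -> -1 <= t <= 1 ->
  exists q : {poly R}, [/\ (size q <= (n %/ d).+1)%N, q.[t] = 1 &
    (\int[lebesgue_measure]_(x in `[(-1)%R, 1%R]) (q.[x] ^+ 2)%:E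
       <= (C * rho n t)%:E)%E].
Proof.
move=> d0; pose D := (3 * d)%N.
have D0 : (0 < D)%N by rewrite muln_gt0.
have DR0 : 0 < D%:R :> R by rewrite ltr0n.
have pi0 := pi_gt0 R.
(* 4 pi comes from the weight bound and the square norm of the kernel, 32 / 7
   from the diagonal of the kernel, and each of the factors a + 1 and k + 1
   costs one D = 3 d. *)
exists (128 / 7 * pi * D%:R ^+ 2); first by rewrite !mulr_gt0 ?exprn_gt0//; lra.
move=> n t n1 t1; pose a := (n %/ D)%N; pose b := t < 0.
have nR0 : 0 < n%:R :> R by rewrite ltr0n.
have tb : (-1) ^+ b * t = `|t|.
  rewrite /b; case: ltP => t0; first by rewrite expr1 mulN1r ltr0_norm.
  by rewrite expr0 mul1r ger0_norm.
have nt1 : -1 <= `|t| <= 1 by rewrite ler_norml t1 (le_trans _ (normr_ge0 _)).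
have ct : cos (acos t) = t by rewrite acosK// in_itv.
have cnt : cos (acos `|t|) = `|t| by rewrite acosK// in_itv.
pose good k := (k <= a)%N && (k%:R ^+ 2 * (1 - `|t|) <= 2^-1).
have ex_good : exists k, good k.
  by exists 0%N; rewrite /good /= expr0n mul0r invr_ge0.
have good_le k : good k -> (k <= a)%N by case/andP.
case: (ex_maxnP ex_good good_le) => k /andP[ka kt] kmax.
pose h := cos_kernel a.*2 (acos t).
pose V := dirichlet R k \Po ((-1) ^+ b *: 'X).
pose W := (dirichlet R k).[`|t|]; pose K := h.[t].
have W1 : k.+1%:R <= W by rewrite /W -cnt; apply: dirichlet_ge; rewrite cnt.
have K1 : 7 / 32 * a.+1%:R <= K.
  by rewrite /K -[t in X in _ <= X]ct; exact: cos_kernel_diag_ge.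
have k0 : 0 < k.+1%:R :> R by rewrite ltr0n.
have a0 : 0 < a.+1%:R :> R by rewrite ltr0n.
have W0 : 0 < W by exact: lt_le_trans W1.
have K0 : 0 < K by apply: lt_le_trans K1; rewrite mulr_gt0//; lra.
exists ((W * K)^-1 *: (V * h)); split.
- rewrite (leq_trans (size_scale_leq _ _))//.
  rewrite (leq_trans (size_polyMleq _ _))//.
  have sV : (size V <= k.+1)%N.
    rewrite (leq_trans (size_comp_poly_leq _ _))//.
    have sX : ((size ((-1) ^+ b *: 'X : {poly R})).-1 <= 1)%N.
      by rewrite -subn1 leq_subLR (leq_trans (size_scale_leq _ _))// size_polyX.
    have := size_dirichlet R k; case: (size _) => [|m]//= mk.
    by rewrite ltnS (leq_trans (leq_mul (leqnn _) sX))// muln1.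
  have sh : (size h <= a.*2.+1)%N := size_cos_kernel _ _.
  have a3 : (3 * a <= n %/ d)%N.
    rewrite leq_divRL// /a -mulnA [(_ * d)%N]mulnC mulnA.
    by rewrite mulnC leq_trunc_div.
  have arith x y l m : (x <= k.+1 -> y <= l.*2.+1 -> k <= l -> 3 * l <= m ->
      (x + y).-1 <= m.+1)%N by clear; lia.
  exact: arith sV sh ka a3.
- rewrite hornerZ hornerM horner_comp hornerZ hornerX tb -/W -/K.
  by rewrite mulVf// mulf_neq0 ?gt_eqF.
have := integral_product_le k a.*2 b (W * K)^-1 (acos t).
rewrite /= -/h -/V ct -/K => /le_trans; apply; rewrite lee_fin.
pose s := Num.sqrt (1 - t ^+ 2).
have s0 : 0 <= s := sqrtr_ge0 _.
have na : n%:R <= D%:R * a.+1%:R :> R.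
  by rewrite -natrM ler_nat mulnC ltnW// ltn_ceil.
(* Either k = a is of order n, or k + 1 violates the smallness condition and is
   then at least of order 1 / s. *)
have ks : D%:R^-1 <= k.+1%:R * (n%:R^-1 + s).
  have [kEa|] := eqVneq k a.
    apply: (@le_trans _ _ (k.+1%:R * n%:R^-1)).
      by rewrite kEa ler_pdivlMr// ler_pdivrMl.
    by rewrite ler_pM2l// lerDl.
  rewrite neq_ltn [(a < k)%N]ltnNge ka orbF => /= lt_ka.
  have kk : 2^-1 < k.+1%:R ^+ 2 * (1 - `|t|).
    rewrite ltNge; apply/negP => le2.
    by have := kmax k.+1; rewrite /good lt_ka le2 ltnn => /(_ isT).
  have ss : 1 - `|t| <= s ^+ 2.
    have tn : t ^+ 2 = `|t| ^+ 2 by rewrite real_normK ?num_real.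
    have nt0 := normr_ge0 t; case/andP: nt1 => _ nt1.
    by rewrite sqr_sqrtr tn; clear -nt0 nt1; nra.
  have : 2^-1 ^+ 2 <= (k.+1%:R * s) ^+ 2.
    rewrite exprMn; apply: (@le_trans _ _ (2^-1)); first lra.
    by rewrite (le_trans (ltW kk))// ler_pM2l// exprn_gt0.
  rewrite ler_sqr ?nnegrE ?mulr_ge0 ?invr_ge0//.
  move=> ks2; apply: (@le_trans _ _ (k.+1%:R * s)).
    rewrite (le_trans _ ks2)// lef_pV2 ?posrE// ler_nat; clear -d0; rewrite /D; lia.
  by rewrite ler_pM2l// lerDr invr_ge0 ltW.
have rhoE : rho n t = n%:R^-1 * (n%:R^-1 + s) by rewrite /rho -/s -exprVn; ring.
have main : D%:R ^- 2 <= k.+1%:R * a.+1%:R * rho n t.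
  rewrite rhoE.
  have -> : k.+1%:R * a.+1%:R * (n%:R^-1 * (n%:R^-1 + s)) =
    (a.+1%:R / n%:R) * (k.+1%:R * (n%:R^-1 + s)) by ring.
  rewrite -exprVn expr2; apply: ler_pM; rewrite ?invr_ge0//.
  by rewrite ler_pdivlMr// ler_pdivrMl.
apply: (@le_trans _ _ (4 * pi * (k.+1%:R * (W ^+ 2 * K)^-1))).
  have -> : (W * K)^-1 ^+ 2 * (2 * (2 * k + 1)%:R * (pi * K)) =
     (2 * pi * (W ^+ 2 * K)^-1) * (2 * k + 1)%:R.
    by field; rewrite !gt_eqF.
  have -> : 4 * pi * (k.+1%:R * (W ^+ 2 * K)^-1) =
     (2 * pi * (W ^+ 2 * K)^-1) * (2 * k.+1)%:R by rewrite natrM; ring.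
  apply: ler_wpM2l; last by rewrite ler_nat; clear; lia.
  by rewrite mulr_ge0 ?invr_ge0 ?mulr_ge0 ?sqr_ge0// ltW.
apply: (@le_trans _ _ (4 * pi * (32 / 7 * (k.+1%:R * a.+1%:R)^-1))).
  rewrite ler_pM2l ?mulr_gt0//.
  have -> : 32 / 7 * (k.+1%:R * a.+1%:R)^-1 =
     k.+1%:R * (k.+1%:R ^+ 2 * (7 / 32 * a.+1%:R))^-1 :> R.
    by field; rewrite !gt_eqF.
  rewrite ler_pM2l// lef_pV2 ?posrE ?mulr_gt0 ?exprn_gt0//.
  apply: ler_pM => //; rewrite ?sqr_ge0 ?mulr_ge0//.
  by rewrite ler_sqr// nnegrE ltW.
have : D%:R ^+ 2 * (k.+1%:R * a.+1%:R * rho n t) >= 1.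
  by rewrite -ler_pdivrMl ?exprn_gt0// mulr1.
have ka0 : 0 < k.+1%:R * a.+1%:R :> R by rewrite mulr_gt0.
move=> m1; rewrite -(ler_pM2r ka0).
have -> : 4 * pi * (32 / 7 * (k.+1%:R * a.+1%:R)^-1) * (k.+1%:R * a.+1%:R) =
  128 / 7 * pi * 1 :> R by field; rewrite !gt_eqF.
have -> : 128 / 7 * pi * D%:R ^+ 2 * rho n t * (k.+1%:R * a.+1%:R) =
  128 / 7 * pi * (D%:R ^+ 2 * (k.+1%:R * a.+1%:R * rho n t)) by ring.
by rewrite ler_pM2l// mulr_gt0//; lra.
Qed.
End integrals.

(** * Affine change of variables *)

Section affine_line.
Variable R : realType.
Notation mu := (@lebesgue_measure R).
Local Open Scope ereal_scope.

Definition line (b a : R) : measurableTypeR R -> measurableTypeR R :=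
  fun x => (b + a * x)%R.

Lemma measurable_line b a : measurable_fun setT (line b a).
Proof. by apply: measurable_funD => //; exact: measurable_funM. Qed.

(** Bundled as a measure, so that the uniqueness of Lebesgue measure applies. *)
Definition line_image (b a : R) : {measure set (measurableTypeR R) -> \bar R} :=
  measure_function_pushforward__canonical__measure_function_Measure mu
    (measurable_line b a).

(** Both sides are measures in [A], and they agree on half-open intervals. *)
Lemma lebesgue_measure_line (b a : R) (A : set (measurableTypeR R)) :
  a != 0%R -> measurable A -> mu A = `|a|%:E * mu (line b a @^-1` A).
Proof.
move=> a0 mA.
pose m := mscale (NngNum (normr_ge0 a)) (line_image b a).
have mE X : m X = `|a|%:E * mu (line b a @^-1` X) by [].
rewrite -mE.
apply: (@lebesgue_measure_unique _ m) => // _ [[p q]] _ <-.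
transitivity (`|a|%:E * mu (line b a @^-1` `]p, q]%classic)); last by [].
rewrite lebesgue_measure_itv/=.
have [apos|aneg] := ltP 0%R a.
  have -> : line b a @^-1` `]p, q]%classic =
      `]((p - b) / a)%R, ((q - b) / a)%R]%classic.
    apply/seteqP; split => x /=;
      rewrite !in_itv/= /line ltr_pdivrMr// ler_pdivlMr//.
      by move=> /andP[? ?]; apply/andP; split; lra.
    by move=> /andP[? ?]; apply/andP; split; lra.
  rewrite lebesgue_measure_itv/= !lte_fin gtr0_norm// ltr_pM2r ?invr_gt0//.
  rewrite ltrD2r; case: ifPn => _; last by rewrite mule0.
  by rewrite -!EFinB -EFinM; congr EFin; field.
have {}aneg : (a < 0)%R by rewrite lt_neqAle a0.
have -> : line b a @^-1` `]p, q]%classic =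
    `[((q - b) / a)%R, ((p - b) / a)%R[%classic.
  apply/seteqP; split => x /=;
    rewrite !in_itv/= /line ltr_ndivlMr// ler_ndivrMr//.
    by move=> /andP[? ?]; apply/andP; split; lra.
  by move=> /andP[? ?]; apply/andP; split; lra.
rewrite lebesgue_measure_itv/= !lte_fin ltr0_norm// ltr_nM2r ?invr_lt0//.
rewrite ltrD2r; case: ifPn => _; last by rewrite mule0.
by rewrite -!EFinB -EFinM; congr EFin; field.
Qed.

Lemma integral_line (b a : R) (f : measurableTypeR R -> \bar R) : a != 0%R ->
  measurable_fun setT f -> (forall x, 0 <= f x) ->
  `|a|%:E * \int[mu]_x f (b + a * x)%R = \int[mu]_x f x.
Proof.
move=> a0 mf f0.
pose m := mscale (NngNum (normr_ge0 a)) (line_image b a).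
transitivity (\int[m]_x f x).
  rewrite ge0_integral_mscale//= ge0_integral_pushforward//.
  exact: measurable_line.
by apply: eq_measure_integral => A mA _; exact/esym/lebesgue_measure_line.
Qed.

End affine_line.

(** Tonelli's theorem for [lebesgue_cV], which is a product measure up to the
    bijection [cons_cV], with the first coordinate integrated last or first. *)
Section fubini_cV.
Variables (R : realType) (d : nat).
Notation mu := (@lebesgue_measure R).
Notation leb := (lebesgue_cV R).
Local Open Scope ereal_scope.
Variable f : 'cV[R]_d.+1 -> \bar R.
Hypothesis mf : measurable_fun setT f.
Hypothesis f0 : forall x, 0 <= f x.

Lemma measurable_fun_cons :
  measurable_fun setT (fun p : measurableTypeR R * 'cV[R]_d => f (cons_cV p)).
Proof. by apply: measurableT_comp => //; exact: measurable_cons_cV. Qed.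

Lemma integral_cV_prod :
  \int[leb d.+1]_x f x = \int[mu \x leb d]_p f (cons_cV p).
Proof.
rewrite /= /lebesgue_cV_succ ge0_integral_pushforward//.
exact: measurable_cons_cV.
Qed.

Lemma integral_cV1 :
  \int[leb d.+1]_x f x = \int[mu]_s \int[leb d]_x f (cons_cV (s, x)).
Proof.
rewrite integral_cV_prod (fubini_tonelli1 (fun p => f (cons_cV p)))//.
exact: measurable_fun_cons.
Qed.

Lemma integral_cV2 :
  \int[leb d.+1]_x f x = \int[leb d]_x \int[mu]_s f (cons_cV (s, x)).
Proof.
rewrite integral_cV_prod (fubini_tonelli2 (fun p => f (cons_cV p)))//.
exact: measurable_fun_cons.
Qed.

Lemma measurable_integral_tail :
  measurable_fun setT
    (fun s : measurableTypeR R => \int[leb d]_x f (cons_cV (s, x))).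
Proof.
exact: (measurable_fun_fubini_tonelli_F (fun p => f (cons_cV p))
  measurable_fun_cons).
Qed.

Lemma measurable_integral_head :
  measurable_fun setT (fun x : 'cV[R]_d => \int[mu]_s f (cons_cV (s, x))).
Proof.
exact: (measurable_fun_fubini_tonelli_G (fun p => f (cons_cV p))
  measurable_fun_cons).
Qed.

End fubini_cV.

Section affine_cV.
Variable R : realType.
Notation mu := (@lebesgue_measure R).
Notation leb := (lebesgue_cV R).

Lemma measurable_affine d (x0 : 'cV[R]_d) (A : 'M[R]_d) :
  measurable_fun setT (affine x0 A).
Proof.
apply: measurable_fun_cVP => i.
have -> : coord_cV i \o affine x0 A =
    (fun x => x0 i ord0 + \sum_j A i j * coord_cV j x).
  by apply/funext => x; rewrite /= /coord_cV /affine !mxE.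
apply: measurable_funD => //; apply: measurable_sum => j.
by apply: measurable_funM => //; exact: measurable_coord_cV.
Qed.

Lemma affine_cons d (s0 s : R) (x0 x : 'cV[R]_d) (a : 'M[R]_1) w v
    (B : 'M[R]_d) :
  affine (cons_cV (s0, x0)) (block_mx a w v B : 'M[R]_(1 + d))
    (cons_cV (s, x)) =
  cons_cV (s0 + a ord0 ord0 * s + (w *m x) ord0 ord0,
           affine (x0 + v *m s%:M) B x).
Proof.
transitivity (col_mx (s0%:M + (a *m s%:M + w *m x))
                     (x0 + (v *m s%:M + B *m x)) : 'cV[R]_(1 + d)).
  by rewrite -add_col_mx -mul_block_col.
rewrite /cons_cV /affine /= addrA [x0 + _]addrA.
suff -> : s0%:M + a *m s%:M + w *m x =
  (s0 + a ord0 ord0 * s + (w *m x) ord0 ord0)%:M by [].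
by apply/matrixP => i j; rewrite !ord1 !mxE !mulr1n big_ord1 !mxE mulr1n.
Qed.

Lemma cons_cV_surj d (x : 'cV[R]_d.+1) :
  x = cons_cV (coord_cV ord0 x, behead_cV x).
Proof.
rewrite /cons_cV /=.
have -> : (coord_cV ord0 x)%:M = @usubmx R 1 d 1 x.
  apply/matrixP => i j; rewrite !ord1 !mxE mulr1n /coord_cV.
  by congr (x _ _); exact: val_inj.
exact/esym/(@vsubmxK R 1 d 1 x).
Qed.

Local Open Scope ereal_scope.

(** Stated as a property of [A] alone, for all offsets and all integrands, so
    that it is visibly closed under products of matrices. *)
Definition change_of_variables d (A : 'M[R]_d) :=
  forall (x0 : 'cV[R]_d) (f : 'cV[R]_d -> \bar R), measurable_fun setT f ->
  (forall x, 0 <= f x) ->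
  `|\det A|%:E * \int[leb d]_x f (affine x0 A x) = \int[leb d]_x f x.

Lemma change_of_variables_mul d (A B : 'M[R]_d) : change_of_variables A ->
  change_of_variables B -> change_of_variables (A *m B)%R.
Proof.
move=> cA cB x0 f mf f0.
have mfA : measurable_fun setT (f \o affine x0 A).
  by apply: measurableT_comp => //; exact: measurable_affine.
rewrite -(cA x0 f mf f0) -(cB 0%R (f \o affine x0 A) mfA); last by move=> x /=.
rewrite det_mulmx normrM EFinM muleA; congr (_ * _).
by apply: eq_integral => x _; rewrite /affine /= add0r mulmxA.
Qed.

(** A block lower triangular matrix shifts the tail of the vector by an amount
    depending on the first coordinate: with that coordinate frozen, the inner
    integral is an affine change of variables for [B]. *)
Lemma change_of_variables_lblock d (a : R) v (B : 'M[R]_d) : a != 0%R ->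
  \det B != 0%R -> change_of_variables B ->
  change_of_variables (block_mx (a%:M : 'M[R]_1) 0 v B : 'M[R]_(1 + d))%R.
Proof.
move=> a0 B0 cB x0 f mf f0; rewrite (cons_cV_surj x0).
set s0 := coord_cV _ _; set y0 := behead_cV _.
set A := block_mx _ _ _ _; pose F := f \o affine (cons_cV (s0, y0)) A.
have mF : measurable_fun setT F.
  by apply: measurableT_comp => //; exact: measurable_affine.
have F0 x : 0 <= F x by exact: f0.
pose g s := \int[leb d]_x f (cons_cV (s, x)).
have FE s : `|\det B|%:E * \int[leb d]_x F (cons_cV (s, x)) = g (s0 + a * s)%R.
  rewrite /g -[RHS](cB (y0 + v *m s%:M)%R)//; last first.
    exact: (measurable_fun_pair2 (f := fun p => f (cons_cV p)) (s0 + a * s)%R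
      (measurable_fun_cons mf)).
  congr (_ * _); apply: eq_integral => x _.
  by rewrite /F /= affine_cons mul0mx !mxE addr0 mulr1n.
rewrite (integral_cV1 mF) ?(integral_cV1 mf)//.
rewrite det_lblock det_scalar1 normrM EFinM.
rewrite -(integral_line s0 a0 (f := g)); last 2 first.
  exact: measurable_integral_tail.
  by move=> x; apply: integral_ge0.
rewrite -muleA -ge0_integralZl//; last 2 first.
  exact: (measurable_integral_tail mF F0).
  by move=> s _; apply: integral_ge0 => x _; exact: f0.
by congr (_ * _); apply: eq_integral => s _; rewrite FE.
Qed.

(** The same with the roles exchanged: the tail is frozen and the inner integral
    is a change of variables on the line. *)
Lemma change_of_variables_ublock d (a : R) w (B : 'M[R]_d) : a != 0%R ->
  \det B != 0%R -> change_of_variables B ->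
  change_of_variables (block_mx (a%:M : 'M[R]_1) w 0 B : 'M[R]_(1 + d))%R.
Proof.
move=> a0 B0 cB x0 f mf f0; rewrite (cons_cV_surj x0).
set s0 := coord_cV _ _; set y0 := behead_cV _.
set A := block_mx _ _ _ _; pose F := f \o affine (cons_cV (s0, y0)) A.
have mF : measurable_fun setT F.
  by apply: measurableT_comp => //; exact: measurable_affine.
have F0 x : 0 <= F x by exact: f0.
pose g x := \int[mu]_s f (cons_cV (s, x)).
have FE x : `|a|%:E * \int[mu]_s F (cons_cV (s, x)) = g (affine y0 B x).
  rewrite /g -[RHS](integral_line (s0 + (w *m x) ord0 ord0)%R a0)//; last first.
    exact: (measurable_fun_pair1 (f := fun p => f (cons_cV p)) _
      (measurable_fun_cons mf)).
  congr (_ * _); apply: eq_integral => s _.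
  by rewrite /F /= affine_cons mul0mx addr0 !mxE mulr1n addrAC.
rewrite (integral_cV2 mF) ?(integral_cV2 mf)//.
rewrite det_ublock det_scalar1 normrM EFinM [X in X * _]muleC.
rewrite -(cB y0 g); last 2 first.
  exact: measurable_integral_head.
  by move=> x; apply: integral_ge0.
rewrite -muleA -ge0_integralZl//; last 2 first.
  exact: (measurable_integral_head mF F0).
  by move=> x _; apply: integral_ge0 => s _; exact: f0.
by congr (_ * _); apply: eq_integral => x _; rewrite FE.
Qed.

(** Induction on the dimension, by block elimination.  If the corner entry is
    nonzero, the matrix is a block lower triangular matrix times a block upper
    triangular one whose corner block is the Schur complement.  Otherwise some
    other entry of the first column is nonzero, and adding its row to the first
    one, a block upper triangular operation, creates a nonzero corner. *)
Theorem integral_affine d (A : 'M[R]_d) :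
  \det A != 0%R -> change_of_variables A.
Proof.
elim: d A => [|d IH] A A0.
  move=> x0 f mf f0; rewrite [A]flatmx0 det_mx00 normr1 mul1e.
  by apply: eq_integral => x _; congr f; apply/matrixP => -[].
have pivot (B : 'M[R]_(1 + d)) : \det B != 0%R -> B ord0 ord0 != 0%R ->
    change_of_variables B.
  move=> B0 b0; rewrite -[B]submxK.
  set a := ulsubmx B; set w := ursubmx B.
  set v := dlsubmx B; set C := drsubmx B.
  have aE : a = (B ord0 ord0)%:M.
    apply/matrixP => i j; rewrite !ord1 !mxE mulr1n.
    by congr (B _ _); exact: val_inj.
  set b := B ord0 ord0 in b0 aE *.
  pose S := (C - b^-1 *: (v *m w))%R.
  have E : block_mx a w v C =
      block_mx (1%:M : 'M[R]_1) 0 (b^-1 *: v) 1%:M *m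
      block_mx (b%:M : 'M[R]_1) w 0 S.
    rewrite mulmx_block !mul1mx !mulmx0 !mul0mx !addr0 aE mul_mx_scalar scalerA.
    by rewrite divff// scale1r /S -scalemxAl addrC subrK.
  have S0 : \det S != 0%R.
    apply: contra B0 => /eqP S0; rewrite -[B]submxK -/a -/w -/v -/C E det_mulmx.
    by rewrite det_ublock S0 mulr0 mulr0.
  rewrite E; apply: change_of_variables_mul.
    apply: change_of_variables_lblock; rewrite ?oner_neq0// ?det1 ?oner_neq0//.
    by apply: IH; rewrite det1 oner_neq0.
  by apply: change_of_variables_ublock => //; exact: IH.
have [a0|] := eqVneq (A ord0 ord0) 0%R; last exact: pivot.
have [i Ai|Ai] := pickP (fun i => A (lift ord0 i) ord0 != 0%R); last first.
  case/negP: A0; rewrite (expand_det_col A ord0) big1// => i _.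
  case: (unliftP ord0 i) => [j ->|->]; last by rewrite a0 mul0r.
  by have /negbFE/eqP -> := Ai j; rewrite mul0r.
pose e : 'rV[R]_d := delta_mx ord0 i.
pose E (w : 'rV[R]_d) : 'M[R]_(1 + d) := block_mx (1%:M : 'M[R]_1) w 0 1%:M.
have detE w : \det (E w) = 1%R by rewrite det_ublock !det1 mulr1.
have EK : E (- e)%R *m E e = 1%:M.
  rewrite mulmx_block !mul1mx !mulmx1 !mulmx0 !mul0mx !addr0 subrr add0r.
  by rewrite -scalar_mx_block.
have -> : A = E (- e)%R *m (E e *m (A : 'M[R]_(1 + d))).
  by rewrite mulmxA EK mul1mx.
apply: change_of_variables_mul.
  apply: change_of_variables_ublock; rewrite ?oner_neq0// ?det1 ?oner_neq0//.
  by apply: IH; rewrite det1 oner_neq0.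
apply: pivot; first by rewrite det_mulmx detE mul1r.
have i0 : ord0 = lshift d (ord0 : 'I_1) by exact: val_inj.
have ri j : lift ord0 j = rshift 1 j by exact: val_inj.
rewrite mxE big_split_ord big_ord1 /=.
rewrite [X in E e X _]i0 block_mxEul mxE mulr1n mul1r -i0 a0 add0r.
rewrite (bigD1 i)//= big1 => [|j ji]; last first.
  by rewrite [X in E e X _]i0 block_mxEur mxE eqxx (negbTE ji) mul0r.
by rewrite [X in E e X _]i0 block_mxEur mxE !eqxx mul1r addr0 -ri.
Qed.

End affine_cV.

(** * Borel sets of column vectors *)

Section borel_cV.
Variables (R : realType) (d : nat).

(** The topology has a countable basis of boxes with rational centres. *)
Lemma measurable_open_cV (U : set 'cV[R]_d) : open U -> measurable U.
Proof.
move=> oU.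
pose box (qk : 'cV[rat]_d * nat) : set 'cV[R]_d :=
  \bigcap_(i in [set: 'I_d]) (coord_cV i @^-1`
    [set` `](ratr (qk.1 i ord0) - qk.2.+1%:R^-1),
            (ratr (qk.1 i ord0) + qk.2.+1%:R^-1)[]).
have mbox qk : measurable (box qk).
  apply: fin_bigcap_measurable; first exact: finite_finset.
  by move=> i _; rewrite -[X in measurable X]setTI; exact: measurable_coord_cV.
suff -> : U = \bigcup_qk (if `[< box qk `<=` U >] then box qk else set0).
  apply: countable_bigcupT_measurable => [|qk]; first exact: countableP.
  by case: ifP.
apply/seteqP; split => [x Ux|x [qk _]]; last by case: asboolP => // sU /sU.
have /nbhs_ballP[e /= e0 eU] : nbhs x U by exact: open_nbhs_nbhs.
have [k ke] : exists k : nat, k.+1%:R^-1 < e / 2.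
  exists (Num.truncn (e / 2)^-1); rewrite invf_plt ?posrE ?divr_gt0//.
  by rewrite truncnS_gt.
have k0 : 0 < k.+1%:R^-1 :> R by rewrite invr_gt0.
have /choice[q qP] (i : 'I_d) : exists q : rat,
    ratr q \in `](x i ord0 - k.+1%:R^-1), (x i ord0 + k.+1%:R^-1)[.
  by apply: rat_in_itvoo; rewrite ltrD2l gtrN.
have bU : box (\col_i q i, k) `<=` U.
  move=> y yb; apply: eU; split => // i j.
  rewrite (_ : j = ord0); last exact: ord1.
  have := yb i I; have := qP i; rewrite /= /coord_cV !mxE !in_itv/= => xq yq.
  rewrite /ball/= ltr_norml; move: xq yq ke => /andP[].
  move: (ratr _) (k.+1%:R^-1) (x i _) (y i _) => a t u v.
  by move=> ? ? /andP[? ?] ?; apply/andP; split; lra.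
exists (\col_i q i, k) => //; rewrite asboolT//.
move=> i _ /=; have := qP i; rewrite /coord_cV !mxE !in_itv/= => /andP[].
by move: (k.+1%:R^-1) => t ? ?; apply/andP; split; lra.
Qed.

Lemma measurable_compact_cV (D : set 'cV[R]_d) : compact D -> measurable D.
Proof.
move=> cD; rewrite -[D]setCK; apply: measurableC; apply: measurable_open_cV.
by apply: closed_openC; apply: compact_closed => //; exact: norm_hausdorff.
Qed.

End borel_cV.

(** * Zero sets of polynomials *)

Section peval.
Variable R : realType.

Lemma pevalE d (p : mpoly.mpoly d R) (x : 'cV[R]_d) : peval p x =
  \sum_(m <- mpoly.msupp p) mpoly.mcoeff m p * \prod_i x i ord0 ^+ m i.
Proof. exact: mpoly.mevalE. Qed.

Lemma measurable_peval d (p : mpoly.mpoly d R) :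
  measurable_fun setT (peval p : 'cV[R]_d -> R).
Proof.
have -> : peval p = fun x => \sum_(m <- mpoly.msupp p)
    (mpoly.mcoeff m p * \prod_i coord_cV i x ^+ m i).
  by apply/funext => x; exact: pevalE.
apply: measurable_sum => m; apply: measurable_funM => //.
apply: measurable_prod => i _; apply: measurable_funX.
exact: measurable_coord_cV.
Qed.

Lemma measurable_zeros d (p : mpoly.mpoly d R) :
  measurable [set x : 'cV[R]_d | peval p x = 0].
Proof.
rewrite -[X in measurable X]setTI.
by have := measurable_peval p; move/(_ measurableT [set 0]); apply.
Qed.

Definition mnm_tail d (m : mpoly.multinom d.+1) : mpoly.multinom d :=
  mpoly.Multinom [tuple m (lift ord0 i) | i < d].

(** The coefficient of the [j]-th power of the first variable, as a polynomial
    in the remaining ones. *)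
Definition head_coef d (p : mpoly.mpoly d.+1 R) (j : nat) : mpoly.mpoly d R :=
  \sum_(m <- mpoly.msupp p | m ord0 == j)
    mpoly.mcoeff m p *: mpoly.mpolyX R (mnm_tail m).

Lemma peval_cons d (p : mpoly.mpoly d.+1 R) (s : R) (x : 'cV[R]_d) :
  peval p (cons_cV (s, x)) =
  (\poly_(j < mpoly.msize p) peval (head_coef p j) x).[s].
Proof.
rewrite pevalE horner_poly.
have msz m : m \in mpoly.msupp p -> (m ord0 < mpoly.msize p)%N.
  move=> mp; apply: leq_ltn_trans (mpoly.msize_mdeg_lt mp).
  by rewrite mpoly.mdegE (bigD1 ord0)//= leq_addr.
transitivity (\sum_(m <- mpoly.msupp p) \sum_(j < mpoly.msize p | m ord0 == j)
   mpoly.mcoeff m p * \prod_i cons_cV (s, x) i ord0 ^+ m i).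
  rewrite big_seq [RHS]big_seq; apply: eq_bigr => m mp.
  by rewrite (big_pred1 (Ordinal (msz m mp)))// => j /=.
rewrite (exchange_big_dep predT)//=; apply: eq_bigr => j _.
rewrite /peval /head_coef raddf_sum/= mulr_suml; apply: eq_bigr => m /eqP mj.
rewrite mpoly.mevalZ mpoly.mevalX -mulrA; congr (_ * _).
rewrite big_ord_recl /= mulrC.
have -> : cons_cV (s, x) ord0 ord0 = s by exact: (coord_cV0_cons (s, x)).
rewrite mj; congr (_ * _); apply: eq_bigr => i _.
rewrite mpoly.mnmE; congr (_ ^+ _).
exact: (coord_cVS_cons (s, x)).
Qed.

(** The leading monomial of [p] survives in the coefficient to which it
    contributes, since two monomials with the same first exponent and the same
    tail are equal. *)
Lemma head_coef_neq0 d (p : mpoly.mpoly d.+1 R) : p != 0 ->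
  exists2 j, (j < mpoly.msize p)%N & head_coef p j != 0.
Proof.
move=> p0; have m0p := mpoly.mlead_supp p0; set m0 := mpoly.mlead p in m0p.
exists (m0 ord0).
  apply: leq_ltn_trans (mpoly.msize_mdeg_lt m0p).
  by rewrite mpoly.mdegE (bigD1 ord0)//= leq_addr.
apply/eqP => /(congr1 (mpoly.mcoeff (mnm_tail m0))).
rewrite raddf_sum/= mpoly.mcoeff0 big_mkcond/= (bigD1_seq m0)//=.
rewrite eqxx mpoly.mcoeffZ mpoly.mcoeffX eqxx mulr1.
rewrite big1 ?addr0; first by apply/eqP; rewrite -mpoly.mcoeff_msupp.
move=> m mm0; case: eqP => // mj; rewrite mpoly.mcoeffZ mpoly.mcoeffX.
case: eqP => [tm|]; last by rewrite mulr0.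
case/eqP: mm0; apply/mpoly.mnmP => i.
case: (unliftP ord0 i) => [k ->|-> //].
by have /mpoly.mnmP/(_ k) := tm; rewrite !mpoly.mnmE.
Qed.

Lemma finite_poly_zeros (u : {poly R}) :
  u != 0 -> finite_set [set s | u.[s] = 0].
Proof.
move=> u0; apply: contrapT => /(@infinite_set_fset _ _ (size u))[B Bu sB].
have := @max_poly_roots R u (finmap.enum_fset B) u0.
rewrite ltnNge sB finmap.fset_uniq => H.
suff : false by []; apply: H => //.
by apply/allP => s sb; apply/eqP; exact: Bu.
Qed.

(** Induction on the number of variables.  Some coefficient with respect to the
    first variable is a nonzero polynomial in the tail; away from its zeros,
    which are null by induction, the section of the zero set is the finite zero
    set of a nonzero univariate polynomial. *)
Theorem lebesgue_zeros d (p : mpoly.mpoly d R) : p != 0 ->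
  lebesgue_cV R d [set x | peval p x = 0] = 0%E.
Proof.
elim: d p => [|d IH] p p0.
  rewrite (_ : [set _ | _] = set0) ?measure0//.
  apply/seteqP; split => // x /=; rewrite pevalE => px.
  case/eqP: p0; apply/mpoly.mpolyP => m; rewrite mpoly.mcoeff0.
  have m0 (k : mpoly.multinom 0) : k = m by apply/mpoly.mnmP => -[].
  apply/eqP; apply: contraT; rewrite -mpoly.mcoeff_msupp => mp.
  move: px; under eq_bigr do rewrite big_ord0 mulr1.
  rewrite (bigD1_seq m)//= big1 => [|k]; last by rewrite (m0 k) eqxx.
  rewrite addr0 => mc.
  by move: mp; rewrite mpoly.mcoeff_msupp mc eqxx.
have [j jp jp0] := head_coef_neq0 p0.
set Z := [set x | _]; have mZ : measurable Z := measurable_zeros p.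
pose f (x : 'cV[R]_d.+1) : \bar R := (\1_Z x)%:E.
have mf : measurable_fun setT f.
  by apply/measurable_EFinP; exact: measurable_indic.
have f0 x : (0 <= f x)%E by rewrite lee_fin.
have -> : lebesgue_cV R d.+1 Z = (\int[lebesgue_cV R d.+1]_x f x)%E.
  by rewrite integral_indic// setIT.
rewrite (integral_cV2 mf f0).
pose N : set 'cV[R]_d := [set x | peval (head_coef p j) x = 0].
rewrite (@ge0_negligible_integral _ _ _ _ setT N)//; last 4 first.
- exact: measurable_zeros.
- exact: measurable_integral_head.
- by move=> x _; apply: integral_ge0.
- exact: IH.
apply: integral0_eq => x [_ Nx].
rewrite -[RHS](@countable_lebesgue_measure0 R [set s | Z (cons_cV (s, x))]).
  rewrite -[in RHS](setIT [set s | _]) -integral_indic//.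
  rewrite -[X in measurable X]setTI.
  by apply: (measurableT_comp (@measurable_cons_cV R d) (measurable_pair2 x)).
apply: finite_set_countable.
rewrite (_ : [set s | _] =
  [set s | (\poly_(i < mpoly.msize p) peval (head_coef p i) x).[s] = 0]).
  apply: finite_poly_zeros; apply/eqP => /(congr1 (fun u : {poly R} => u`_j)).
  by rewrite coef_poly jp coef0 => /Nx.
by apply/funext => s; rewrite /Z /= peval_cons.
Qed.

End peval.

(** * Integrals of products of functions of one coordinate *)

Section prod_integral.
Variable R : realType.
Notation mu := (@lebesgue_measure R).
Local Open Scope ereal_scope.

Lemma integral_prod_le d (g : 'I_d -> R -> R) (a : 'I_d -> R) :
  (forall i, measurable_fun setT (g i)) -> (forall i s, (0 <= g i s)%R) ->
  (forall i, \int[mu]_s (g i s)%:E <= (a i)%:E) ->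
  \int[lebesgue_cV R d]_x (\prod_i g i (coord_cV i x))%:E <= (\prod_i a i)%:E.
Proof.
elim: d g a => [|d IH] g a mg g0 ga.
  under eq_integral do rewrite big_ord0.
  by rewrite integral_cst//= mul1e big_ord0 diracT.
have mprod m (h : 'I_m -> R -> R) : (forall i, measurable_fun setT (h i)) ->
    measurable_fun setT (fun x : 'cV[R]_m => (\prod_i h i (coord_cV i x))%:E).
  move=> mh; apply/measurable_EFinP; apply: measurable_prod => i _.
  exact: (measurableT_comp (mh i) (measurable_coord_cV i)).
rewrite integral_cV1; [|exact: mprod|by move=> x; rewrite lee_fin prodr_ge0].
pose P (x : 'cV[R]_d) := (\prod_i g (lift ord0 i) (coord_cV i x))%R.
have P0 x : (0 <= P x)%R by rewrite prodr_ge0.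
have tailP : \int[lebesgue_cV R d]_x (P x)%:E <= (\prod_i a (lift ord0 i))%:E.
  by apply: (IH (fun i => g (lift ord0 i)) (fun i => a (lift ord0 i))).
have tail_fin : \int[lebesgue_cV R d]_x (P x)%:E \is a fin_num.
  rewrite ge0_fin_numE; first exact: le_lt_trans tailP (ltry _).
  by apply: integral_ge0 => x _; rewrite lee_fin.
have innerE (s : R) :
    \int[lebesgue_cV R d]_x (\prod_i g i (coord_cV i (cons_cV (s, x))))%:E =
    (g ord0 s)%:E * \int[lebesgue_cV R d]_x (P x)%:E.
  rewrite -ge0_integralZl_EFin//; last 2 first.
  - by move=> x _; rewrite lee_fin.
  - exact: (mprod _ (fun i => g (lift ord0 i)) (fun i => mg _)).
  apply: eq_integral => x _; rewrite big_ord_recl coord_cV0_cons -EFinM /P.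
  by congr ((_ * _)%:E); apply: eq_bigr => i _; rewrite coord_cVS_cons.
under eq_integral do rewrite innerE.
rewrite -(fineK tail_fin) in tailP *; rewrite ge0_integralZr//; last 3 first.
- exact: (measurable_EFinP _ _).2 (mg ord0).
- by move=> s _; rewrite lee_fin.
- by rewrite lee_fin fine_ge0// integral_ge0// => x _; rewrite lee_fin.
rewrite big_ord_recl EFinM; apply: lee_pmul => //.
  by apply: integral_ge0 => s _; rewrite lee_fin.
by rewrite lee_fin fine_ge0// integral_ge0// => x _; rewrite lee_fin.
Qed.

End prod_integral.

(** * Orthonormalization of a positive definite matrix *)

Section congruence.
Variable R : realType.

Definition posdef N (G : 'M[R]_N) := G^T = G /\
  forall u : 'rV[R]_N, u != 0 -> 0 < (u *m G *m u^T) ord0 ord0.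

Lemma posdef_congr N (G E : 'M[R]_N) : E \in unitmx -> posdef G ->
  posdef (E *m G *m E^T).
Proof.
move=> uE [sG pG]; split; first by rewrite !trmx_mul trmxK sG mulmxA.
move=> u u0; have := pG (u *m E); rewrite trmx_mul !mulmxA; apply.
by apply: contra u0 => /eqP uE0; rewrite -(mulmxK uE u) uE0 mul0mx.
Qed.

(** Gram-Schmidt in matrix form: clear the first row and column by a congruence,
    apply induction to the Schur complement, which is again positive definite,
    and rescale the corner. *)
Lemma posdef_orthonormalize N (G : 'M[R]_N) : posdef G ->
  exists2 B : 'M[R]_N, B \in unitmx & B *m G *m B^T = 1%:M.
Proof.
elim: N G => [|N IH] G pG.
  by exists 1%:M; [exact: unitmx1|apply/matrixP => -[]].
pose a := G ord0 ord0.
have i0 : ord0 = lshift N (ord0 : 'I_1) by exact: val_inj.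
have aE (H : 'M[R]_(1 + N)) : ulsubmx H = (H ord0 ord0)%:M.
  by apply/matrixP => i j; rewrite !ord1 !mxE mulr1n i0.
have [sG qG] := pG.
have a0 : 0 < a.
  have := qG (delta_mx ord0 ord0).
  rewrite trmx_delta -rowE -colE !mxE; apply.
  apply/eqP => /matrixP/(_ ord0 ord0); rewrite !mxE !eqxx.
  exact/eqP/oner_neq0.
pose w := @ursubmx R 1 N 1 N G; pose H := @drsubmx R 1 N 1 N G.
have GE : G = block_mx (a%:M : 'M[R]_1) w w^T H :> 'M[R]_(1 + N).
  rewrite -[LHS](@submxK R 1 N 1 N) aE -/w -/H.
  by rewrite -[X in dlsubmx X]sG -trmx_ursub.
pose E : 'M[R]_(1 + N) := block_mx (1%:M : 'M[R]_1) 0 (- a^-1 *: w^T) 1%:M.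
have uE : E \in unitmx by rewrite unitmxE det_lblock !det1 mulr1 unitr1.
pose S := H - a^-1 *: (w^T *m w).
have EGE : E *m (G : 'M[R]_(1 + N)) *m E^T = block_mx (a%:M : 'M[R]_1) 0 0 S.
  rewrite GE /E tr_block_mx !mulmx_block !trmx1 !trmx0 !mul1mx !mul0mx !mulmx1.
  rewrite !mulmx0 !addr0 linearZ/= trmxK mul_scalar_mx mul_mx_scalar scalerA.
  rewrite scalerA mulrN divff ?gt_eqF// !scaleN1r !addNr mul0mx add0r.
  by rewrite -scalemxAl scaleNr addrC.
have pS : posdef S.
  have [] := posdef_congr uE pG.
  rewrite EGE tr_block_mx => /eq_block_mx[_ _ _ sS] q.
  split=> // u u0; have := q (row_mx 0 u); rewrite mul_row_block tr_row_mx.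
  rewrite !mul0mx !mulmx0 !add0r mul_row_col trmx0 mulmx0 add0r; apply.
  apply: contra u0 => /eqP/(congr1 (@rsubmx _ _ _ _)).
  by rewrite row_mxKr linear0 => ->.
have [B uB BSB] := IH S pS.
pose C : 'M[R]_(1 + N) := block_mx ((Num.sqrt a)^-1%:M : 'M[R]_1) 0 0 B.
have sa0 : 0 < Num.sqrt a by rewrite sqrtr_gt0.
have uC : C \in unitmx.
  rewrite unitmxE det_lblock det_scalar1 unitrM -unitmxE uB.
  by rewrite andbT unitfE invr_eq0 gt_eqF.
exists (C *m E); first by rewrite unitmx_mul uE andbT; exact: uC.
transitivity (C *m (E *m (G : 'M[R]_(1 + N)) *m E^T) *m C^T).
  by rewrite trmx_mul !mulmxA.
rewrite EGE /C tr_block_mx !mulmx_block !trmx0 !mul0mx !mulmx0 !addr0 !add0r BSB.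
rewrite mul0mx mul0mx tr_scalar_mx -!scalar_mxM.
rewrite (_ : _ * _ = 1) -?scalar_mx_block//.
by rewrite mulrAC -invfM -expr2 sqr_sqrtr ?ltW// mulVf// gt_eqF.
Qed.

End congruence.

(** * Orthonormal bases and the extremal property *)

Section inner_product.
Variables (R : realType) (d : nat) (D : set 'cV[R]_d).
Hypothesis cD : compact D.
Notation leb := (lebesgue_cV R d).
Implicit Types p q : mpoly.mpoly d R.

Let mD : measurable D := measurable_compact_cV cD.

Lemma compact_coord_bounded :
  exists2 M : R, 0 <= M & forall x, D x -> forall i, `|coord_cV i x| <= M.
Proof.
have [M [Mreal DM]] := compact_bounded cD.
exists (`|M| + 1); first by rewrite addr_ge0.
move=> x Dx i; have := DM (`|M| + 1).
rewrite ltr_pwDr ?ler_norm// => /(_ isT x Dx); apply: le_trans.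
rewrite /coord_cV; have := @mx_normrE R _ _ x; rewrite /Num.norm/= => ->.
exact: (le_bigmax _ (fun ij => `|x ij.1 ij.2|) (i, ord0)).
Qed.

(** A compact set lies in a cube, whose measure is bounded by
    [integral_prod_le]. *)
Lemma compact_finite_measure_cV : (leb D < +oo)%E.
Proof.
have [M M0 DM] := compact_coord_bounded.
pose I : set R := [set` `[- M, M]].
have mI : measurable I by exact: measurable_itv.
have mI1 : measurable_fun [set: R] (\1_I : R -> R) by exact: measurable_indic.
have -> : leb D = (\int[leb]_(x in D) 1)%E by rewrite integral_cst// mul1e.
apply: (@le_lt_trans _ _
    (\int[leb]_x (\prod_(i < d) (\1_I (coord_cV i x) : R))%:E)%E).
  rewrite integral_mkcond; apply: ge0_le_integral => //.
  - by move=> x _; rewrite patchE; case: ifP.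
  - exact/(measurable_restrictT _ _).1.
  - apply/measurable_EFinP; apply: measurable_prod => i _.
    exact: (measurableT_comp mI1 (measurable_coord_cV i)).
  move=> x _; rewrite patchE; case: ifPn => [/set_mem Dx|_]; last first.
    by rewrite lee_fin prodr_ge0.
  rewrite big1// => i _; rewrite indicE mem_set// /I/= in_itv/= -ler_norml.
  exact: DM.
apply: le_lt_trans (ltry (\prod_(i < d) (2 * M))).
apply: (integral_prod_le (g := fun _ => \1_I) (a := fun _ => 2 * M)) => [i||i].
- exact: measurable_indic.
- by move=> i s; rewrite indicE.
rewrite integral_indic// setIT -[leLHS]/(lebesgue_measure I).
rewrite lebesgue_measure_itv/= lte_fin.
case: ifP => _; rewrite lee_fin ?mulr_ge0//; lra.
Qed.

Lemma peval_bounded p : exists K : R, forall x, D x -> `|peval p x| <= K.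
Proof.
have [M M0 DM] := compact_coord_bounded.
exists (\sum_(m <- mpoly.msupp p) `|mpoly.mcoeff m p| * \prod_(i < d) M ^+ m i).
move=> x Dx; rewrite pevalE (le_trans (ler_norm_sum _ _ _))//.
apply: ler_sum => m _; rewrite normrM ler_wpM2l// normr_prod.
apply: ler_prod => i _; rewrite normr_ge0 normrX/= lerXn2r ?nnegrE//.
exact: DM.
Qed.

Lemma integrable_peval p : leb.-integrable D (EFin \o peval p).
Proof.
apply: measurable_bounded_integrable => //.
- exact: compact_finite_measure_cV.
- exact: measurable_funTS (measurable_peval p).
have [K DK] := peval_bounded p.
exists K; split; rewrite ?num_real// => r Kr x Dx.
exact: le_trans (DK x Dx) (ltW Kr).
Qed.

Definition inner p q : R := Rintegral leb D (fun x => peval p x * peval q x).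

Lemma pevalM p q x : peval (p * q) x = peval p x * peval q x.
Proof. exact: mpoly.mevalM. Qed.

Lemma integrable_pevalM p q :
  leb.-integrable D (EFin \o (fun x => peval p x * peval q x)).
Proof.
have := integrable_peval (p * q); congr (_.-integrable D _).
by apply/funext => x /=; rewrite pevalM.
Qed.

Lemma innerE p q :
  (\int[leb]_(x in D) (peval p x * peval q x)%:E)%E = (inner p q)%:E.
Proof.
rewrite /inner /Rintegral fineK//.
exact: integrable_fin_num (integrable_pevalM p q).
Qed.

Lemma innerC p q : inner p q = inner q p.
Proof. by rewrite /inner; apply: eq_Rintegral => x _; rewrite mulrC. Qed.

Lemma inner_suml (I : Type) (r : seq I) (a : I -> R)
    (e : I -> mpoly.mpoly d R) q :
  inner (\sum_(i <- r) a i *: e i) q = \sum_(i <- r) a i * inner (e i) q.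
Proof.
elim: r => [|i r IH].
  rewrite !big_nil /inner -[RHS](mulr0 (Rintegral leb D (fun=> 0))).
  rewrite (@eq_Rintegral _ _ _ _ _ (cst 0)) => [|x _]; last first.
    by rewrite /peval mpoly.meval0 mul0r.
  by rewrite Rintegral_cst// mul0r mulr0.
rewrite !big_cons -IH /inner -RintegralZl//; last exact: integrable_pevalM.
rewrite -RintegralD//; last 2 first.
- by have := integrable_pevalM (a i *: e i) q; congr (_.-integrable D _);
    apply/funext => x /=; rewrite /peval mpoly.mevalZ mulrA.
- exact: integrable_pevalM.
apply: eq_Rintegral => x _.
by rewrite /peval mpoly.mevalD mpoly.mevalZ mulrDl mulrA.
Qed.

Lemma inner_sum (I J : finType) (a : I -> R) (b : J -> R)
    (e : I -> mpoly.mpoly d R) (f : J -> mpoly.mpoly d R) :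
  inner (\sum_i a i *: e i) (\sum_j b j *: f j) =
  \sum_i \sum_j a i * b j * inner (e i) (f j).
Proof.
rewrite inner_suml; apply: eq_bigr => i _.
rewrite innerC inner_suml mulr_sumr; apply: eq_bigr => j _.
by rewrite innerC mulrA.
Qed.

Hypothesis D0 : (0 < leb D)%E.

(** If [int_D p^2 = 0] then [p] vanishes almost everywhere on [D], so [D] is
    covered by a null set and the zeros of [p], contradicting its positive
    measure. *)
Lemma inner_gt0 p : p != 0 -> 0 < inner p p.
Proof.
move=> p0; rewrite lt_neqAle eq_sym andbC Rintegral_ge0/=; last first.
  by move=> x _; rewrite -expr2 sqr_ge0.
apply/eqP => ip0.
have int0 : (\int[leb]_(x in D) `|(peval p x * peval p x)%:E| = 0)%E.
  rewrite -[RHS]/(0%R%:E) -ip0 -innerE; apply: eq_integral => x _.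
  by rewrite gee0_abs// lee_fin -expr2 sqr_ge0.
have mpp : measurable_fun D (fun x => (peval p x * peval p x)%:E).
  by apply/measurable_EFinP; apply: measurable_funTS; apply: measurable_funM;
    exact: measurable_peval.
have [N [mN N0 DN]] := (ae_eq_integral_abs leb mD mpp).1 int0.
have mZ := measurable_zeros p.
have DNZ : D `<=` N `|` [set x | peval p x = 0].
  move=> x Dx; have [px|px] := eqVneq (peval p x) 0; [by right|left].
  apply: DN => /(_ Dx)/= [/eqP]; rewrite mulf_eq0 orbb => /eqP px0.
  by rewrite px0 eqxx in px.
have : (leb D <= leb (N `|` [set x | peval p x = 0%R]))%E.
  by apply: le_measure; rewrite ?inE//; exact: measurableU.
rewrite leNgt; apply/negP/negPn.
apply: le_lt_trans D0; apply: (le_trans (measureU2 _ mN mZ)).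
have N_le0 : (leb N <= 0)%E by rewrite N0.
have Z_le0 : (leb [set x | peval p x = 0%R] <= 0)%E by rewrite lebesgue_zeros.
by rewrite -[leRHS]adde0; exact: leeD N_le0 Z_le0.
Qed.

Variable n : nat.
Notation monos := (mpoly.bmultinom d n.+1).

Definition monomial (k : 'I_#|{: monos}|) : mpoly.mpoly d R :=
  mpoly.mpolyX R (mpoly.bmnm (enum_val k)).

Lemma monomial_basis : is_basis n monomial.
Proof.
split.
- move=> k; rewrite /poly_space/= /monomial mpoly.msizeX ltnS -ltnS.
  exact: valP (enum_val k).
- move=> a a0 k; have := congr1 (mpoly.mcoeff (mpoly.bmnm (enum_val k))) a0.
  rewrite mpoly.mcoeff0 raddf_sum/= (bigD1 k)//=.
  rewrite mpoly.mcoeffZ mpoly.mcoeffX eqxx mulr1.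
  rewrite big1 ?addr0// => j jk; rewrite mpoly.mcoeffZ mpoly.mcoeffX.
  by rewrite (inj_eq val_inj) (inj_eq enum_val_inj) (negbTE jk) mulr0.
move=> p pn; exists (fun k => mpoly.mcoeff (mpoly.bmnm (enum_val k)) p).
rewrite {1}(mpoly.mpolywE pn) (reindex_onto enum_val enum_rank)/=; last first.
  by move=> m _; rewrite enum_rankK.
by apply: eq_big => // k; rewrite enum_valK eqxx.
Qed.

(** The Gram matrix of the monomials is positive definite by [inner_gt0]; the
    rows of a matrix that orthonormalizes it are the coefficients of the basis. *)
Lemma exists_orthonormal_basis : exists N (phi : 'I_N -> mpoly.mpoly d R),
  is_basis n phi /\ orthonormal_in D phi.
Proof.
have [eS eI eB] := monomial_basis.
set N := #|_| in eS eI eB; pose e := monomial.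
pose G : 'M[R]_N := \matrix_(i, j) inner (e i) (e j).
have innerG (u v : 'rV[R]_N) :
    inner (\sum_i u ord0 i *: e i) (\sum_i v ord0 i *: e i) =
    (u *m G *m v^T) ord0 ord0.
  rewrite inner_sum mxE exchange_big/=; apply: eq_bigr => j _.
  rewrite !mxE mulr_suml; apply: eq_bigr => i _.
  by rewrite !mxE mulrAC.
have pG : posdef G.
  split; first by apply/matrixP => i j; rewrite !mxE innerC.
  move=> u u0; rewrite -innerG inner_gt0//; apply: contra u0 => /eqP /eI u0.
  by apply/eqP/rowP => i; rewrite mxE u0.
have [B uB BGB] := posdef_orthonormalize pG.
pose phi (k : 'I_N) := \sum_j B k j *: e j.
have phiE (a : 'I_N -> R) :
    \sum_k a k *: phi k = \sum_j ((\row_k a k) *m B) ord0 j *: e j.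
  under eq_bigr do rewrite scaler_sumr.
  rewrite exchange_big/=; apply: eq_bigr => j _.
  rewrite mxE scaler_suml; apply: eq_bigr => k _.
  by rewrite scalerA mxE.
exists N, phi; split; first split.
- move=> k; rewrite /poly_space/=.
  apply: (leq_trans (mpoly.mmeasure_sum _ _ _ _)).
  apply/bigmax_leqP => j _; exact: leq_trans (mpoly.msizeZ_le _ _) (eS j).
- move=> a; rewrite phiE => /eI aB k.
  have : (\row_k a k) *m B = 0 by apply/rowP => j; rewrite aB mxE.
  move/(congr1 (mulmx^~ (invmx B))); rewrite mulmxK// mul0mx => /rowP/(_ k).
  by rewrite !mxE.
- move=> p /eB[a ->]; exists (fun k => ((\row_k a k) *m invmx B) ord0 k).
  rewrite phiE; apply: eq_bigr => j _; congr (_ *: _).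
  rewrite (_ : \row_k _ = (\row_k a k) *m invmx B); last first.
    by apply/rowP => k; rewrite mxE.
  by rewrite mulmxKV// mxE.
move=> j k; rewrite innerE; congr EFin.
have rowE i : \sum_l (row i B) ord0 l *: e l = phi i.
  by apply: eq_bigr => l _; rewrite mxE.
rewrite -!rowE innerG tr_row -!row_mul.
have := congr1 (fun M : 'M[R]_N => M j k) BGB; rewrite [in X in _ = X]mxE => <-.
rewrite [LHS]mxE [LHS]mxE [RHS]mxE; apply: eq_bigr => i _.
by rewrite [col _ _ _ _]mxE.
Qed.

(** Write [q = sum_k a_k phi_k] in an orthonormal basis that yields the value
    of [christoffel].  Then [sum_k a_k^2 = int_D q^2 <= I] and
    [sum_k a_k phi_k(x) = q(x) = 1], and Cauchy-Schwarz gives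
    [1 <= I * sum_k phi_k(x)^2]. *)
Theorem christoffel_ge (x : 'cV[R]_d) (q : mpoly.mpoly d R) (I : R) :
  poly_space n q -> peval q x = 1 -> 0 < I ->
  (\int[leb]_(z in D) (peval q z ^+ 2)%:E <= I%:E)%E ->
  I^-1 <= christoffel n D x.
Proof.
move=> qn qx I0 qI; rewrite /christoffel; set P := [set v | _].
have [N0 [phi0 [bphi0 ophi0]]] := exists_orthonormal_basis.
have : P (get P).
  by apply: getPex; exists (\sum_k peval (phi0 k) x ^+ 2), N0, phi0.
move=> [N [phi [[_ _ spans] ophi ->]]].
have [a qE] := spans q qn.
set V := \sum_k _.
have S_le : \sum_k a k ^+ 2 <= I.
  rewrite -lee_fin; apply: le_trans qI.
  under eq_integral do rewrite expr2.
  rewrite innerE lee_fin qE inner_sum; apply: ler_sum => i _.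
  rewrite (bigD1 i)//= big1 ?addr0 => [|j ji].
    by have := ophi i i; rewrite innerE eqxx => -[->]; rewrite mulr1 expr2.
  by have := ophi i j; rewrite innerE eq_sym (negbTE ji) => -[->]; rewrite mulr0.
have ab : \sum_k a k * peval (phi k) x = 1.
  rewrite -qx qE /peval raddf_sum/=; apply: eq_bigr => k _.
  by rewrite mpoly.mevalZ.
(* Among the sums of (a_k - t phi_k(x))^2, the choice t = I gives the best bound
   and avoids a division by a sum that might vanish. *)
have : 0 <= \sum_k (a k - I * peval (phi k) x) ^+ 2.
  by apply: sumr_ge0 => k _; exact: sqr_ge0.
have -> : \sum_k (a k - I * peval (phi k) x) ^+ 2 =
    \sum_k a k ^+ 2 - 2 * I * (\sum_k a k * peval (phi k) x) + I ^+ 2 * V.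
  rewrite /V !mulr_sumr -sumrB -big_split/=; apply: eq_bigr => k _; ring.
rewrite ab => ge0.
have : I <= I ^+ 2 * V by lra.
by rewrite expr2 -mulrA ler_pMr// -ler_pdivrMl// mulr1.
Qed.

End inner_product.

(** * The multivariate test polynomial *)

Section polynomial_degree.
Variables (R : realType) (d : nat).
Implicit Types p l : mpoly.mpoly d R.

Lemma poly_space_mul a b p q : poly_space a p -> poly_space b q ->
  poly_space (a + b)%N (p * q).
Proof.
rewrite /poly_space/= => pa qb.
have [->|p0] := eqVneq p 0; first by rewrite mul0r mpoly.msize0.
have [->|q0] := eqVneq q 0; first by rewrite mulr0 mpoly.msize0.
rewrite mpoly.msizeM// -ltnS prednK; first by rewrite -addSn -addnS leq_add.
by rewrite addn_gt0 lt0n mpoly.msize_poly_eq0 p0.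
Qed.

Lemma poly_space_le a b p : (a <= b)%N -> poly_space a p -> poly_space b p.
Proof. by rewrite /poly_space/= => ab pa; rewrite (leq_trans pa). Qed.

Lemma poly_space1 : @poly_space R d 0 1.
Proof. by rewrite /poly_space/= mpoly.msize1. Qed.

Lemma poly_space_sum (I : eqType) (r : seq I) a (f : I -> mpoly.mpoly d R) :
  (forall i, poly_space a (f i)) -> poly_space a (\sum_(i <- r) f i).
Proof.
move=> fa; apply: (leq_trans (mpoly.mmeasure_sum _ _ _ _)).
by apply/bigmax_leqP_seq => i _ _; exact: fa.
Qed.

Lemma poly_space_scale a (c : R) p : poly_space a p -> poly_space a (c *: p).
Proof. by apply: leq_trans; exact: mpoly.msizeZ_le. Qed.

Lemma poly_space_prod (I : Type) (r : seq I) a (f : I -> mpoly.mpoly d R) :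
  (forall i, poly_space a (f i)) ->
  poly_space (size r * a)%N (\prod_(i <- r) f i).
Proof.
move=> fa; elim: r => [|i r IH]; first by rewrite big_nil; exact: poly_space1.
by rewrite big_cons mulSn; exact: poly_space_mul.
Qed.

Definition subst (q : {poly R}) l : mpoly.mpoly d R :=
  \sum_(k < size q) q`_k *: l ^+ k.

Lemma peval_subst q l x : peval (subst q l) x = q.[peval l x].
Proof.
rewrite horner_coef /peval /subst raddf_sum/=; apply: eq_bigr => k _.
by rewrite mpoly.mevalZ rmorphXn.
Qed.

Lemma poly_space_subst m (q : {poly R}) l :
  poly_space 1 l -> (size q <= m.+1)%N -> poly_space m (subst q l).
Proof.
move=> l1 qm; apply: poly_space_sum => k; apply: poly_space_scale.
apply: (@poly_space_le k); first by rewrite -ltnS (leq_trans (ltn_ord k)).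
elim: (k : nat) => [|j IH]; first by rewrite expr0; exact: poly_space1.
by rewrite exprS -add1n; exact: poly_space_mul.
Qed.

Definition affine_form (w : 'rV[R]_d) (c : R) : mpoly.mpoly d R :=
  \sum_j w ord0 j *: mpoly.mpolyX R (mpoly.mnm1 j) + c *: 1.

Lemma peval_affine_form w c x :
  peval (affine_form w c) x = (w *m x) ord0 ord0 + c.
Proof.
rewrite /peval mpoly.mevalD mpoly.mevalZ mpoly.meval1 mulr1 mxE raddf_sum/=.
by congr (_ + _); apply: eq_bigr => j _; rewrite mpoly.mevalZ mpoly.mevalXU.
Qed.

Lemma poly_space_affine_form w c : poly_space 1 (affine_form w c).
Proof.
rewrite /poly_space/= (leq_trans (mpoly.mmeasureD_le _ _ _))// geq_max.
apply/andP; split; last first.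
  by apply: (leq_trans (mpoly.msizeZ_le _ _)); rewrite mpoly.msize1.
apply: poly_space_sum => j; apply: poly_space_scale.
by rewrite /poly_space/= mpoly.msizeX mpoly.mdeg1.
Qed.

End polynomial_degree.

(** The integrand is nonnegative, so [D] may be enlarged to the image of the
    cube; there the change of variables turns the integral into that of a product of
    functions of one coordinate over the cube. *)
Lemma integral_affine_cube_le (R : realType) (d : nat) (x0 : 'cV[R]_d)
    (A : 'M[R]_d) (D : set 'cV[R]_d) (q : 'I_d -> {poly R}) (a : 'I_d -> R) :
  \det A != 0 -> measurable D -> D `<=` affine x0 A @` cube R d ->
  (forall i, \int[lebesgue_measure]_(s in `[(-1)%R, 1%R]) ((q i).[s] ^+ 2)%:E
     <= (a i)%:E)%E ->
  (\int[lebesgue_cV R d]_(x in D)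
     ((\prod_i (q i).[(invmx A *m (x - x0)) i ord0]) ^+ 2)%:E
   <= (`|\det A| * \prod_i a i)%:E)%E.
Proof.
move=> A0 mD DA qa; have uA : A \in unitmx by rewrite unitmxE unitfE.
pose g i (s : R) := (q i).[s] ^+ 2 * \1_[set` `[(-1)%R, 1%R]] s.
have g0 i s : 0 <= g i s by rewrite mulr_ge0 ?sqr_ge0// indicE.
have mg i : measurable_fun setT (g i).
  apply: measurable_funM; last exact: measurable_indic.
  by apply: measurable_funX; exact: measurable_poly.
pose h (x : 'cV[R]_d) := \prod_i g i (coord_cV i x).
pose F (x : 'cV[R]_d) : \bar R := (h (invmx A *m (x - x0)))%:E.
have mh : measurable_fun setT h.
  apply: measurable_prod => i _.
  exact: (measurableT_comp (mg i) (measurable_coord_cV i)).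
have mF : measurable_fun setT F.
  have -> : F = EFin \o (h \o affine (- (invmx A *m x0)) (invmx A)).
    by apply/funext => x; rewrite /F/= /affine mulmxBr addrC.
  apply/measurable_EFinP; apply: measurableT_comp => //.
  exact: measurable_affine.
have F0 x : (0 <= F x)%E by rewrite lee_fin prodr_ge0.
have FA x : F (affine x0 A x) = (h x)%:E.
  by rewrite /F /affine addrAC subrr add0r mulKmx.
apply: (@le_trans _ _ (\int[lebesgue_cV R d]_x F x)%E).
  apply: (@le_trans _ _ (\int[lebesgue_cV R d]_(x in D) F x)%E); last first.
    by apply: ge0_subset_integral.
  rewrite le_eqVlt; apply/orP; left; apply/eqP.
  apply: eq_integral => x /set_mem Dx.
  rewrite /F /h -prodrXl; congr EFin; apply: eq_bigr => i _.
  have [z zc <-] := DA _ Dx.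
  rewrite /affine addrAC subrr add0r mulKmx// /g /coord_cV indicE mem_set ?mulr1//.
  by rewrite /= in_itv/=; exact: zc.
rewrite -(integral_affine A0 x0 mF F0) EFinM; apply: lee_pmul => //.
  exact: integral_ge0.
under eq_integral do rewrite FA.
apply: integral_prod_le => // i; apply: le_trans (qa i).
rewrite [leRHS]integral_mkcond; rewrite le_eqVlt; apply/orP; left; apply/eqP.
apply: eq_integral => s _; rewrite patchE /g indicE.
by case: ifPn => _; rewrite ?mulr1 ?mulr0.
Qed.

Theorem theorem6p3 (R : realType) (d : nat) (hd : (1 <= d)%N) :
  exists2 c : R, 0 < c &
    forall (n : nat) (D : set 'cV[R]_d) (y : 'cV[R]_d)
           (x0 : 'cV[R]_d) (A : 'M[R]_d),
      (1 <= n)%N ->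
      compact D ->
      (0 < lebesgue_cV R d D)%E ->
      cube R d y ->
      \det A != 0 ->
      D `<=` affine x0 A @` cube R d ->
      D (affine x0 A y) ->
      christoffel n D (affine x0 A y) >=
        c * `|\det A|^-1 * \prod_(i < d) (rho n (y i ord0))^-1.
Proof.
have [C C0 localized] := @localized_poly R d hd.
exists (C ^+ d)^-1; first by rewrite invr_gt0 exprn_gt0.
move=> n D y x0 A n1 cD D0 yc A0 DA Dy.
have uA : A \in unitmx by rewrite unitmxE unitfE.
have /choice[q qP] i := localized n (y i ord0) n1 (yc i).
pose Q : mpoly.mpoly d R := \prod_i subst (q i)
  (affine_form (row i (invmx A)) (- (invmx A *m x0) i ord0)).
have QE x : peval Q x = \prod_i (q i).[(invmx A *m (x - x0)) i ord0].
  rewrite /Q /peval rmorph_prod/=; apply: eq_bigr => i _.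
  rewrite -/(peval _ x) peval_subst peval_affine_form mulmxBr -row_mul.
  congr (_.[_]); rewrite [X in X + _]mxE [RHS]mxE; congr (_ + _).
  by rewrite [RHS]mxE.
pose I := `|\det A| * \prod_i (C * rho n (y i ord0)).
have rho0 i : 0 < rho n (y i ord0).
  apply: ltr_pwDl; first by rewrite invr_gt0 exprn_gt0// ltr0n.
  by rewrite mulr_ge0 ?invr_ge0 ?sqrtr_ge0.
have -> :
    (C ^+ d)^-1 * `|\det A|^-1 * \prod_(i < d) (rho n (y i ord0))^-1 = I^-1.
  rewrite /I big_split/= prodr_const card_ord prodfV -!invfM; congr _^-1; ring.
apply: (@christoffel_ge R d D cD D0 n _ Q).
- have qS i : poly_space (n %/ d) (subst (q i)
      (affine_form (row i (invmx A)) (- (invmx A *m x0) i ord0))).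
    by apply: poly_space_subst; [exact: poly_space_affine_form|have [] := qP i].
  apply: poly_space_le (poly_space_prod (index_enum 'I_d) qS).
  by rewrite -[index_enum _]enumT size_enum_ord mulnC leq_trunc_div.
- rewrite QE big1// => i _; rewrite /affine addrAC subrr add0r mulKmx//.
  by have [] := qP i.
- by rewrite mulr_gt0 ?normr_gt0// prodr_gt0// => i _; rewrite mulr_gt0.
under eq_integral do rewrite QE.
apply: integral_affine_cube_le => // [|i]; first exact: measurable_compact_cV.
by have [] := qP i.
Qed.
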